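(* Let $U$ be a linear subspace of $\mathbb{R}^n$ endowed with the induced action of $W=W(U)$, and assume that the restrictions $E_i|_U$, $1\le i\le n$, of the elementary symmetric functions generate the algebra $\mathbb{R}[U]^W$. Consider a smooth curve $c:\mathbb{R}\to E(U)=U/W$ (smooth as a curve in $\mathbb{R}^n$), and let $t_0\in\mathbb{R}$. If $c$ is normally nonflat at $t_0$ with respect to the ambient stratification of $U/W$, then $c$ is normally nonflat at $t_0$ with respect to the orbit type stratification of $U/W$.
   Context: The symmetric group $S_n$ acts on $\mathbb{R}^n$ by permuting coordinates. $E=(E_1,\dots,E_n):\mathbb{R}^n\to\mathbb{R}^n$, where $E_j(x)=\sum_{i_1<\dots<i_j}x_{i_1}\cdots x_{i_j}$ is the $j$-th elementary symmetric function; $E$ is an orbit map for $S_n$ and $E(\mathbb{R}^n)$ is identified with $\mathbb{R}^n/S_n$. For a linear subspace $U\subseteq\mathbb{R}^n$ put $N(U)=\{\tau\in S_n:\tau.U=U\}$, $Z(U)=\{\tau\in S_n:\tau.x=x\text{ for all }x\in U\}$ and $W(U)=N(U)/Z(U)$, which acts effectively on $U$. $\mathbb{R}[U]^W$ is the algebra of $W$-invariant polynomials on $U$. If the $E_i|_U$ generate $\mathbb{R}[U]^W$, then $E|_U$ induces a homeomorphism $U/W\to E(U)$, by which these spaces are identified. Normal nonflatness. Let a finite group $G$ act orthogonally on a finite dimensional Euclidean space $V$, and let $\sigma=(\sigma_1,\dots,\sigma_m):V\to\mathbb{R}^m$ be an orbit map, its components being homogeneous generators of $\mathbb{R}[V]^G$;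 identify $V/G$ with $\sigma(V)$. For a conjugacy class $(H)$ of subgroups of $G$ let $V_{(H)}$ be the set of $v\in V$ whose isotropy group $G_v$ belongs to $(H)$. The orbit type stratification of $V/G$ consists of the connected components of the manifolds $V_{(H)}/G$. For $s\in\mathbb{N}_0$ let $A_s\subseteq\sigma(V)$ be the union of all orbit type strata of dimension $\le s$ ($A_{-1}=\emptyset$), and let $I_s$ be the ideal of all polynomial functions on $\sigma(V)$ (equivalently, of elements of $\mathbb{R}[V]^G$) vanishing on $A_{s-1}$. Let $c:\mathbb{R}\to\sigma(V)\subseteq\mathbb{R}^m$ be a smooth curve (smooth as a curve in $\mathbb{R}^m$), $t\in\mathbb{R}$, and let $s=s(c,t)$ be the minimal integer such that $c(J)\subseteq A_s$ for some neighborhood $J$ of $t$. The curve $c$ is normally nonflat at $t$ if there is $f\in I_s$ such that the Taylor series of $f\circ c$ at $t$ is not identically zero. For a smooth curve $c:\mathbb{R}\to E(U)$: ''normally nonflat at $t_0$ with respect to the orbit type stratification of $U/W$'' means that $c$ is normally nonflat at $t_0$ as a curve in $\sigma(V)=V/G$ for $G=W$, $V=U$, $\sigma=E|_U$, i.e., there is $f\in I_s$, $s=s(c,t_0)$, such that the Taylor series of $f\circ c$ at $t_0$ is not identically zero, where $A_s$, $I_s$ and $s(c,t_0)$ are formed with respect to the orbit type stratification of $U/W=E(U)$; ''normally nonflat at $t_0$ with respect to the ambient stratification of $U/W$'' means that $c$, regarded as a curve in $E(\mathbb{R}^n)=\mathbb{R}^n/S_n$, is normally nonflat at $t_0$ as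 a curve in $\sigma(V)=V/G$ for $G=S_n$, $V=\mathbb{R}^n$, $\sigma=E$, i.e., there is $f\in I_s$, $s=s(c,t_0)$, such that the Taylor series of $f\circ c$ at $t_0$ is not identically zero, where $A_s$, $I_s$ and $s(c,t_0)$ are formed with respect to the orbit type stratification of $\mathbb{R}^n/S_n=E(\mathbb{R}^n)$. *)

(* Defs.v *)
From HB Require Import structures.
From mathcomp Require Import all_boot all_order all_algebra all_fingroup.
From mathcomp Require Import all_classical all_reals all_analysis.

Set Implicit Arguments.
Unset Strict Implicit.
Unset Printing Implicit Defensive.

Import Order.TTheory GRing.Theory Num.Theory.
Import numFieldNormedType.Exports.

Local Open Scope classical_set_scope.
Local Open Scope ring_scope.

(* Polynomials are handled as polynomial functions; nothing is lost over the
   infinite field R. *)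
Section PolynomialFunctions.
Variable R : realType.

(* The unital algebra of real functions on T generated by S. *)
Inductive gen_algebra (T : Type) (S : set (T -> R)) : (T -> R) -> Prop :=
| gen_algebra_cst (a : R) : gen_algebra S (fun=> a)
| gen_algebra_gen f : S f -> gen_algebra S f
| gen_algebra_add f g :
    gen_algebra S f -> gen_algebra S g -> gen_algebra S (fun x => f x + g x)
| gen_algebra_mul f g :
    gen_algebra S f -> gen_algebra S g -> gen_algebra S (fun x => f x * g x).

Definition poly_fun (V : vectType R) : set (V -> R) :=
  gen_algebra [set f : V -> R | exists h : {linear V -> R^o}, f = h].

Definition invariant_poly (gT : finGroupType) (G : {set gT}) (V : vectType R)
    (to : action G V) : set (V -> R) :=
  [set f | poly_fun f /\ forall g x, g \in G -> f (to x g) = f x].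

End PolynomialFunctions.

Section Submanifolds.
Variable R : realType.

Definition iter_derive (V W : normedModType R) (vs : seq V) (f : V -> W) :
    V -> W :=
  foldr (fun v g x => 'D_v g x) f vs.

Definition smooth_on (V W : normedModType R) (O : set V) (f : V -> W) :=
  forall vs x, O x -> differentiable (iter_derive vs f) x.

(* The manifolds V_(H)/G are used through their images in R^m under the orbit
   map, which are embedded submanifolds; their dimension is measured there.
   S is an embedded d-dimensional smooth submanifold of R^m, described by local
   parametrizations: immersions that are homeomorphisms onto relatively open
   subsets of S. *)
Definition submanifold (m d : nat) (S : set 'rV[R]_m) :=
  forall p, S p -> exists (O : set 'rV[R]_d) (N : set 'rV[R]_m)
    (phi : 'rV[R]_d -> 'rV[R]_m) (psi : 'rV[R]_m -> 'rV[R]_d),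
  [/\ open O /\ open_nbhs p N,
      smooth_on O phi,
      forall u, O u -> injective ('d phi u),
      phi @` O = S `&` N &
      (forall u, O u -> psi (phi u) = u) /\ {within S `&` N, continuous psi}].

Definition smooth_curve (m : nat) (c : R -> 'rV[R]_m) :=
  forall k t, derivable (derive1n k c) t 1.

End Submanifolds.

(* G acts on V, and sigma : V -> R^m is an orbit map, by which V/G is identified
   with the subset range sigma of R^m. *)
Section NormalNonflatness.
Variables (R : realType) (gT : finGroupType) (G : {group gT}).
Variables (V : eqType) (to : action G V) (m : nat) (sigma : V -> 'rV[R]_m).

Definition isotropy (v : V) : {set gT} := [set g in G | to v g == v].

(* V_(H) *)
Definition isotropy_type (H : {group gT}) : set V :=
  [set v | exists2 g, g \in G & isotropy v = (H :^ g)%g].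

Definition orbit_type_stratum (S : set 'rV[R]_m) :=
  exists2 H : {group gT}, H \subset G &
  exists2 y, (sigma @` isotropy_type H) y &
    S = connected_component (sigma @` isotropy_type H) y.

(* The set A_s; it is empty for s = -1. *)
Definition skeleton (s : int) : set 'rV[R]_m :=
  [set y | exists (S : set 'rV[R]_m) (d : nat),
    [/\ orbit_type_stratum S, submanifold d S, d%:Z <= s & S y]].

(* The ideal I_s; a polynomial function on range sigma is represented by a
   polynomial function on R^m. *)
Definition stratum_ideal (s : int) : set ('rV[R]_m -> R) :=
  [set f | poly_fun f /\ forall y, skeleton (s - 1) y -> f y = 0].

Definition stratum_level (c : R -> 'rV[R]_m) (t : R) (s : nat) :=
  (\forall u \near t, skeleton s%:Z (c u)) /\
  forall r : nat, (\forall u \near t, skeleton r%:Z (c u)) -> (s <= r)%N.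

Definition normally_nonflat (c : R -> 'rV[R]_m) (t : R) :=
  exists2 s : nat, stratum_level c t s &
  exists2 f, stratum_ideal s%:Z f &
  exists k, derive1n k (fun u => f (c u)) t / k`!%:R != 0.

End NormalNonflatness.

Section SymmetricGroup.
Variables (R : realType) (n : nat).

Definition elem_sym (x : 'rV[R]_n) : 'rV[R]_n :=
  \row_(j < n) \sum_(A : {set 'I_n} | #|A| == j.+1) \prod_(i in A) x 0 i.

(* MathComp actions are right actions and (s * t) i = t (s i); with the inverse
   below, coordinate i of sym_act x s is coordinate s^-1 i of x. *)
Definition sym_act (x : 'rV[R]_n) (s : 'S_n) : 'rV[R]_n := col_perm s^-1%g x.

Lemma sym_actE x s i : sym_act x s 0 i = x 0 (s^-1%g i).
Proof. by rewrite mxE. Qed.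

Lemma sym_act1 x : sym_act x 1%g = x.
Proof. by apply/rowP => i; rewrite sym_actE invg1 perm1. Qed.

Lemma sym_actM x s t : sym_act x (s * t)%g = sym_act (sym_act x s) t.
Proof. by apply/rowP => i; rewrite !sym_actE invMg permM. Qed.

Lemma sym_actK s : cancel (sym_act^~ s) (sym_act^~ s^-1%g).
Proof. by move=> x; rewrite -sym_actM mulgV sym_act1. Qed.

Lemma sym_actKV s : cancel (sym_act^~ s^-1%g) (sym_act^~ s).
Proof. by move=> x; rewrite -sym_actM mulVg sym_act1. Qed.

Lemma sym_is_action : is_action [set: 'S_n]%G sym_act.
Proof.
split=> [s|x s t _ _]; first exact: can_inj (sym_actK s).
exact: sym_actM.
Qed.

Canonical sym_action := Action sym_is_action.

Section Subspace.
Variable U : {vspace 'rV[R]_n}.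

Definition subspace_norm : {set 'S_n} :=
  [set s | `[< sym_act^~ s @` [set` U] = [set` U] >]]%SET.

Definition subspace_cent : {set 'S_n} :=
  [set s | `[< forall x, x \in U -> sym_act x s = x >]]%SET.

Lemma subspace_normP s :
  reflect (sym_act^~ s @` [set` U] = [set` U]) (s \in subspace_norm).
Proof. by rewrite inE; exact: asboolP. Qed.

Lemma subspace_centP s :
  reflect (forall x, x \in U -> sym_act x s = x) (s \in subspace_cent).
Proof. by rewrite inE; exact: asboolP. Qed.

Lemma subspace_norm_group_set : group_set subspace_norm.
Proof.
apply/group_setP; split=> [|s t /subspace_normP sU /subspace_normP tU].
  by apply/subspace_normP; apply: eq_image_id => x _; rewrite sym_act1.
apply/subspace_normP; rewrite -[RHS]tU -[in RHS]sU image_comp.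
by apply: eq_imagel => x _ /=; rewrite sym_actM.
Qed.

Canonical subspace_norm_group := Group subspace_norm_group_set.

Lemma subspace_cent_group_set : group_set subspace_cent.
Proof.
apply/group_setP; split=> [|s t /subspace_centP sU /subspace_centP tU].
  by apply/subspace_centP => x _; rewrite sym_act1.
by apply/subspace_centP => x xU; rewrite sym_actM sU // tU.
Qed.

Canonical subspace_cent_group := Group subspace_cent_group_set.

Lemma subspace_norm_mem s x :
  s \in subspace_norm -> x \in U -> sym_act x s \in U.
Proof.
move=> /subspace_normP sU xU.
have : (sym_act^~ s @` [set` U]) (sym_act x s) by exists x.
by rewrite sU.
Qed.

Lemma subspace_cent_normal : normal subspace_cent subspace_norm.
Proof.
apply/normalP; split=> [|t tN].
  apply/fintype.subsetP => s /subspace_centP sU.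
  by apply/subspace_normP; apply: eq_image_id => x; exact: sU.
have sub u : u \in subspace_norm -> (subspace_cent :^ u)%g \subset subspace_cent.
  move=> uN; apply/fintype.subsetP => _ /imsetP[z /subspace_centP zU ->].
  apply/subspace_centP => x xU; rewrite conjgE !sym_actM zU ?sym_actKV //.
  by apply: subspace_norm_mem => //; rewrite groupV.
apply/eqP; rewrite finset.eqEsubset sub //=.
by rewrite -sub_conjgV sub ?groupV.
Qed.

(* W(U) = N(U)/Z(U). *)
Definition weyl : {group coset_of subspace_cent} :=
  (subspace_norm / subspace_cent)%G.

(* The value outside weyl is irrelevant; see weyl_act_coset. *)
Definition weyl_act (x : subvs_of U) (w : coset_of subspace_cent) :
    subvs_of U :=
  if w \in weyl then vsproj U (sym_act (vsval x) (repr w)) else x.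

Lemma weyl_act_coset x s : s \in subspace_norm ->
  vsval (weyl_act x (coset subspace_cent s)) = sym_act (vsval x) s.
Proof.
move=> sN; have /andP[_ /fintype.subsetP nZ] := subspace_cent_normal.
rewrite /weyl_act mem_quotient //.
have : repr (coset subspace_cent s) \in (subspace_cent :* s)%g.
  by rewrite -val_coset ?nZ // mem_repr_coset.
case/rcosetP=> z /subspace_centP zU ->.
by rewrite sym_actM zU ?subvsP // vsprojK // subspace_norm_mem ?subvsP.
Qed.

Lemma weyl_is_action : is_action weyl weyl_act.
Proof.
split=> [w x y|x _ _ /morphimP[s nZs sN ->] /morphimP[t nZt tN ->]].
  have [/morphimP[s _ sN ->] xy|/negPf wN] := boolP (w \in weyl); last first.
    by rewrite /weyl_act wN.
  apply/val_inj/(can_inj (sym_actK s)).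
  by rewrite -!weyl_act_coset // xy.
apply/val_inj; rewrite /= -morphM //= !weyl_act_coset ?groupM //.
exact: sym_actM.
Qed.

Canonical weyl_action := Action weyl_is_action.

Definition elem_sym_on (x : subvs_of U) : 'rV[R]_n := elem_sym (vsval x).

End Subspace.
End SymmetricGroup.

(* Main.v *)
Require Import Defs.
From HB Require Import structures.
From mathcomp Require Import all_boot all_order all_algebra all_fingroup.
From mathcomp Require Import all_classical all_reals all_analysis.
From mathcomp Require Import ring lra.
From mathcomp Require mpoly.

Import Order.TTheory GRing.Theory Num.Theory.
Import numFieldNormedType.Exports.
Local Open Scope classical_set_scope.
Local Open Scope ring_scope.
(** Write E for the orbit map given by the elementary symmetric functions.  For a
    finite group G acting through coordinate permutations on a space V, and for
    which the components of E generate the invariants, the orbit type stratum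
    of E(x) is a manifold of dimension dim V^{G_x} ([type_dim], [skeletonE]).
    It has at least this dimension because E is an immersion on V^{G_x} near x
    ([sigma_immersive], [submanifold_dim_ge]), and exactly this one because E
    restricted to V^{G_x} is a chart near x, by [sigma_separates]
    ([stratum_submanifold_at]).  This describes the skeletons of both
    stratifications: of R^n/S_n, where the generation of the invariants is the
    fundamental theorem on symmetric polynomials, and of U/W, where it is the
    hypothesis.

    Let s be the ambient level of c at t0, and f a polynomial that vanishes on
    the ambient skeleton of dimension s - 1 such that f o c is not flat at t0; let
    s' be the level for U/W.  The W-invariant

      F(u) = prod_K sum_(k in K) |k u - u|^2,

    where K runs through the subsets of W with dim U^K < s', vanishes exactly where
    the stratum of u has dimension < s' ([lowdim]), so that F = P o E with P in the
    ideal of level s'.  It remains to see that P o c is not flat at t0.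

    Both f and F compare with the gaps between the coordinates of u.  If u has
    ambient type dimension <= s and u_i <> u_j, replacing the entries equal to
    u_j by u_i lowers this dimension, so f o E vanishes at the new point; as
    f o E is locally Lipschitz, |f(E(u))| <= L |u_i - u_j|
    ([coordinate_separation]).  On the other hand, if the stratum of u has
    dimension >= s', each K contains an element that moves u, hence replaces
    some coordinate by a different one, and F(u) is bounded below by a power of the
    smallest nonzero |u_i - u_j| ([lowdim_lower_bound]).  Together
    F(u) >= (|f(E(u))| / L)^M.

    As f o c is not flat, |f(c(t))| >= C |t - t0|^m near t0
    ([smooth_nonflat_lower]).  If P o c were flat, the last inequality would
    fail for every t <> t0 near t0, so that c(t) would lie in strata of
    dimension < s' for these t; the same holds at t0, where P(c(t0)) = 0.  This
    contradicts the minimality of s'. *)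

Set Implicit Arguments.
Unset Strict Implicit.
Unset Printing Implicit Defensive.

(** * Polynomial functions *)

Section GenAlgebra.
Variable R : realType.

Section Closure.
Variables (T : Type) (S : set (T -> R)).
Implicit Types f g : T -> R.

Lemma gen_algebra_sub f g :
  gen_algebra S f -> gen_algebra S g -> gen_algebra S (fun x => f x - g x).
Proof.
move=> Sf Sg; rewrite (_ : (fun x => _) = fun x => f x + (-1) * g x).
  apply: gen_algebra_add => //; apply: gen_algebra_mul => //.
  exact: gen_algebra_cst.
by apply/funext => x; rewrite mulN1r.
Qed.

Lemma gen_algebra_sum I (r : seq I) (P : pred I) (F : I -> T -> R) :
  (forall i, P i -> gen_algebra S (F i)) ->
  gen_algebra S (fun x => \sum_(i <- r | P i) F i x).
Proof.
move=> SF; elim: r => [|i r IH].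
  by under eq_fun do rewrite big_nil; exact: gen_algebra_cst.
rewrite (_ : (fun x => _) = if P i then fun x =>
    F i x + \sum_(j <- r | P j) F j x else fun x => \sum_(j <- r | P j) F j x).
  by case: ifP => // Pi; apply: gen_algebra_add => //; exact: SF.
by apply/funext => x; rewrite big_cons; case: ifP.
Qed.

Lemma gen_algebra_prod I (r : seq I) (P : pred I) (F : I -> T -> R) :
  (forall i, P i -> gen_algebra S (F i)) ->
  gen_algebra S (fun x => \prod_(i <- r | P i) F i x).
Proof.
move=> SF; elim: r => [|i r IH].
  by under eq_fun do rewrite big_nil; exact: gen_algebra_cst.
rewrite (_ : (fun x => _) = if P i then fun x =>
    F i x * \prod_(j <- r | P j) F j x else fun x => \prod_(j <- r | P j) F j x).
  by case: ifP => // Pi; apply: gen_algebra_mul => //; exact: SF.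
by apply/funext => x; rewrite big_cons; case: ifP.
Qed.

Lemma gen_algebra_exp f k : gen_algebra S f -> gen_algebra S (fun x => f x ^+ k).
Proof.
move=> Sf; elim: k => [|k IH]; first exact: gen_algebra_cst.
by under eq_fun do rewrite exprS; exact: gen_algebra_mul.
Qed.

End Closure.

Lemma gen_algebra_comp (T T' : Type) (S : set (T -> R)) (S' : set (T' -> R))
    (phi : T' -> T) (f : T -> R) :
  (forall g, S g -> gen_algebra S' (g \o phi)) ->
  gen_algebra S f -> gen_algebra S' (f \o phi).
Proof.
move=> SS'; elim=> {f} [a|f /SS' //|f g _ Sf _ Sg|f g _ Sf _ Sg].
- exact: gen_algebra_cst.
- exact: gen_algebra_add.
- exact: gen_algebra_mul.
Qed.

Lemma poly_fun_linear (V : vectType R) (f : V -> R) :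
  linear (f : V -> R^o) -> poly_fun f.
Proof.
move=> lf; apply: gen_algebra_gen.
pose fM := GRing.isLinear.Build R V R^o *:%R f lf.
pose fL : {linear V -> R^o} := HB.pack f fM.
by exists fL.
Qed.

Lemma poly_fun_comp_linear (V W : vectType R) (phi : {linear V -> W}) f :
  poly_fun f -> poly_fun (f \o phi).
Proof.
apply: gen_algebra_comp => _ [h ->]; apply: poly_fun_linear => a u v /=.
by rewrite !linearP.
Qed.

(** Turns continuity along a line, in a space that carries no topology, into
    continuity of a polynomial in one variable. *)
Lemma poly_fun_line (V : vectType R) (f : V -> R) x h : poly_fun f ->
  exists p : {poly R}, forall t, f (x + t *: h) = p.[t].
Proof.
elim=> {f} [a|_ [l ->]|f g _ [p pE] _ [q qE]|f g _ [p pE] _ [q qE]].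
- by exists a%:P => t; rewrite hornerC.
- exists ((l x : R)%:P + (l h : R) *: 'X) => t.
  by rewrite !hornerE linearD linearZ /= mulrC.
- by exists (p + q) => t; rewrite hornerD pE qE.
- by exists (p * q) => t; rewrite hornerM pE qE.
Qed.

Definition coord_funs n : set ('rV[R]_n -> R) :=
  [set f | exists i, f = fun x : 'rV[R]_n => x 0 i].

Lemma poly_fun_coord n (i : 'I_n) : poly_fun (fun x : 'rV[R]_n => x 0 i).
Proof. by apply: poly_fun_linear => a u v; rewrite !mxE. Qed.

Lemma poly_fun_coordP n (f : 'rV[R]_n -> R) :
  poly_fun f <-> gen_algebra (@coord_funs n) f.
Proof.
split; last first.
  apply: (@gen_algebra_comp _ _ _ _ id) => _ [i ->]; exact: poly_fun_coord.
apply: (@gen_algebra_comp _ _ _ _ id) => _ [h ->].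
rewrite (_ : _ \o _ = fun x : 'rV[R]_n => \sum_j x 0 j * h (delta_mx 0 j)).
  apply: gen_algebra_sum => j _; apply: gen_algebra_mul.
    by apply: gen_algebra_gen; exists j.
  exact: gen_algebra_cst.
apply/funext => x /=; rewrite [in LHS](row_sum_delta x) linear_sum.
by apply: eq_bigr => j _; rewrite linearZ.
Qed.

Lemma poly_fun_elem_sym n (j : 'I_n) :
  poly_fun (fun x : 'rV[R]_n => elem_sym x 0 j).
Proof.
under eq_fun do rewrite mxE.
apply: gen_algebra_sum => A _; apply: gen_algebra_prod => i _.
exact: poly_fun_coord.
Qed.

Lemma poly_fun_comp_elem_sym n (f : 'rV[R]_n -> R) :
  poly_fun f -> poly_fun (f \o @elem_sym R n).
Proof.
move/poly_fun_coordP; apply: gen_algebra_comp => _ [j ->].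
exact: poly_fun_elem_sym.
Qed.

End GenAlgebra.

(** * Analysis of polynomial functions *)

Section PolyAnalysis.
Variable R : realType.

Lemma coord_le_norm n (x : 'rV[R]_n) i : `|x 0 i| <= `|x|.
Proof.
rewrite [leRHS]/Num.Def.normr/= mx_normrE.
exact: (le_bigmax _ (fun ij : 'I_1 * 'I_n => `|x ij.1 ij.2|) (0, i)).
Qed.

Lemma norm_le_coord n (x : 'rV[R]_n) e :
  0 <= e -> (forall i, `|x 0 i| <= e) -> `|x| <= e.
Proof.
move=> e0 xe; rewrite [leLHS]/Num.Def.normr/= mx_normrE.
by apply: bigmax_le => // -[i j] _ /=; rewrite (ord1 i).
Qed.

Lemma poly_fun_differentiable n (f : 'rV[R]_n -> R) x :
  poly_fun f -> differentiable f x.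
Proof.
move/poly_fun_coordP; elim=> {f} [a|_ [i ->]|f g _ df _ dg|f g _ df _ dg].
- exact: differentiable_cst.
- exact: differentiable_coord.
- exact: differentiableD.
- exact: differentiableM.
Qed.

Lemma poly_fun_continuous n (f : 'rV[R]_n -> R) : poly_fun f -> continuous f.
Proof.
by move=> pf x; apply: differentiable_continuous; exact: poly_fun_differentiable.
Qed.

Lemma poly_fun_derive n (f : 'rV[R]_n -> R) v :
  poly_fun f -> poly_fun ('D_v f).
Proof.
move/poly_fun_coordP => pf; apply/poly_fun_coordP; move: pf.
have dif g x : gen_algebra (@coord_funs R n) g -> derivable g x v.
  by move=> /poly_fun_coordP pg; apply/diff_derivable/poly_fun_differentiable.
elim=> {f} [a|_ [i ->]|f g pf df pg dg|f g pf df pg dg].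
- rewrite (_ : 'D_v _ = fun=> 0); first exact: gen_algebra_cst.
  by apply/funext => x; exact: derive_cst.
- rewrite (_ : 'D_v _ = fun=> v 0 i); first exact: gen_algebra_cst.
  apply/funext => x; have dx : derivable (@id 'rV[R]_n) x v by [].
  have := derive_mx dx; rewrite derive_id => /(congr1 (fun A : 'rV_n => A 0 i)).
  by rewrite mxE.
- rewrite (_ : 'D_v _ = fun x => 'D_v f x + 'D_v g x).
    exact: gen_algebra_add.
  by apply/funext => x; rewrite -deriveD //; exact: dif.
- rewrite (_ : 'D_v _ = fun x => f x * 'D_v g x + g x * 'D_v f x).
    by apply: gen_algebra_add; exact: gen_algebra_mul.
  by apply/funext => x; rewrite -[RHS]deriveM //; exact: dif.
Qed.

(** The bound on the values is part of the statement because the Lipschitz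
    constant of a product needs it. *)
Lemma poly_fun_bounded_lipschitz n (f : 'rV[R]_n -> R) B : poly_fun f ->
  exists2 L, 0 < L & forall x y, `|x| <= B -> `|y| <= B ->
    `|f x| <= L /\ `|f x - f y| <= L * `|x - y|.
Proof.
move/poly_fun_coordP; elim=> {f} [a|_ [i ->]|f g _ [L L0 Lf] _ [M M0 Mg]
  |f g _ [L L0 Lf] _ [M M0 Mg]].
- exists (1 + `|a|) => [|x y _ _]; first by rewrite ltr_wpDr.
  by rewrite subrr normr0 mulr_ge0 ?addr_ge0 // lerDr.
- exists (1 + `|B|) => [|x y xB yB]; first by rewrite ltr_wpDr.
  split; last first.
    rewrite -[leLHS]mul1r ler_pM // ?lerDl //.
    by have := coord_le_norm (x - y) i; rewrite !mxE.
  rewrite (le_trans (coord_le_norm _ _)) // (le_trans xB) //.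
  by rewrite (le_trans (ler_norm _)) // lerDr.
- exists (L + M) => [|x y xB yB]; first exact: addr_gt0.
  have [f1 f2] := Lf _ _ xB yB; have [g1 g2] := Mg _ _ xB yB; split.
    by rewrite (le_trans (ler_normD _ _)) // lerD.
  by rewrite opprD addrACA (le_trans (ler_normD _ _)) // mulrDl lerD.
- have LM : 0 < L * M by exact: mulr_gt0.
  exists (L * M *+ 2) => [|x y xB yB]; first by rewrite pmulrn_lgt0.
  have [f1 f2] := Lf _ _ xB yB; have [g1 g2] := Mg _ _ xB yB.
  have [g3 _] := Mg _ _ yB xB.
  split.
    rewrite normrM (@le_trans _ _ (L * M)) ?ler_pM // mulr2n lerDl; exact: ltW.
  rewrite (_ : _ - _ = f x * (g x - g y) + (f x - f y) * g y); last by ring.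
  rewrite (le_trans (ler_normD _ _)) // mulrnAl mulr2n lerD //.
    by rewrite normrM -mulrA ler_pM.
  by rewrite normrM mulrAC ler_pM.
Qed.

Definition poly_map d n (f : 'rV[R]_d -> 'rV[R]_n) :=
  forall j, poly_fun (fun x => f x 0 j).

Lemma poly_map_differentiable d n (f : 'rV[R]_d -> 'rV[R]_n) x :
  poly_map f -> differentiable f x.
Proof.
move=> pf; rewrite (_ : f = \sum_j (fun y => f y 0 j *: delta_mx 0 j)).
  apply: differentiable_sum => j; apply: differentiableZl.
  exact: poly_fun_differentiable.
by apply/funext => y; rewrite fct_sumE -row_sum_delta.
Qed.

Lemma poly_map_derive d n (f : 'rV[R]_d -> 'rV[R]_n) v :
  poly_map f -> poly_map ('D_v f).
Proof.
move=> pf j; rewrite (_ : (fun _ => _) = 'D_v (fun x => f x 0 j)).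
  exact: poly_fun_derive.
apply/funext => x; rewrite derive_mx ?mxE //.
exact/diff_derivable/poly_map_differentiable.
Qed.

Lemma poly_map_smooth d n (O : set 'rV[R]_d) (f : 'rV[R]_d -> 'rV[R]_n) :
  poly_map f -> smooth_on O f.
Proof.
move=> pf vs x _; apply: poly_map_differentiable.
by elim: vs => //= v vs IH; exact: poly_map_derive.
Qed.

End PolyAnalysis.

(** * Dimension of embedded submanifolds *)

Section Tangent.
Variable R : realType.

Lemma linear_poly_map d n (L : {linear 'rV[R]_d -> 'rV[R]_n}) : poly_map L.
Proof. by move=> j; apply: poly_fun_linear => a u v; rewrite linearP !mxE. Qed.

Lemma linear_bounded d n (L : {linear 'rV[R]_d -> 'rV[R]_n}) :
  exists2 C, 0 < C & forall u, `|L u| <= C * `|u|.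
Proof.
apply: linear_lipschitz => x; apply: differentiable_continuous.
exact/poly_map_differentiable/linear_poly_map.
Qed.

Lemma injective_row_free d n (L : {linear 'rV[R]_d -> 'rV[R]_n}) :
  injective L -> row_free (lin1_mx L).
Proof.
move=> injL; rewrite -kermx_eq0; apply/eqP/row_matrixP => i.
apply: injL; rewrite row0 linear0 -mul_rV_lin1 -row_mul mulmx_ker.
by rewrite row0.
Qed.

Lemma injective_linear_bounded_below d n (L : {linear 'rV[R]_d -> 'rV[R]_n}) :
  injective L -> exists2 C, 0 < C & forall u, `|u| <= C * `|L u|.
Proof.
move=> /injective_row_free Lfree.
have [C C0 CP] := linear_bounded (mulmxr (pinvmx (lin1_mx L))).
exists C => // u; have := CP (L u).
by rewrite /= -mul_rV_lin1 mulmxKp.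
Qed.

Lemma diff_approx d n (f : 'rV[R]_d -> 'rV[R]_n) x (e : R) :
  differentiable f x -> 0 < e ->
  \forall y \near x, `|f y - f x - 'd f x (y - x)| <= e * `|y - x|.
Proof.
move=> df e0; have /eqaddoP/(_ _ e0) := diff_locally df.
move=> /nbhs_ballP[r r0 rP]; apply/nbhs_ballP; exists r => // y xy.
have : ball 0 r (y - x).
  by move: xy; rewrite -!ball_normE /= sub0r opprB.
by move/rP; rewrite /= !fctE /= subrK opprD addrA.
Qed.

(** Tangent vectors of S at a point lie in the image of the differential of any
    chart phi', so an immersion phi into S cannot have more variables than
    phi'.  The lift psi' o phi is only known to be continuous; since phi' is an
    immersion it is nevertheless Lipschitz at u, which is enough to compare the
    first order terms of phi and phi'. *)
Lemma submanifold_dim_ge d d' n (S : set 'rV[R]_n)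
    (phi : 'rV[R]_d -> 'rV[R]_n) u :
  submanifold d' S -> differentiable phi u -> injective ('d phi u) ->
  (\forall w \near u, S (phi w)) -> (d <= d')%N.
Proof.
move=> manS dphi injphi Sphi.
have Sp := nbhs_singleton Sphi.
have [A [N [phi' [psi' [[_ Nn] smo inj' im [psiK psic]]]]]] := manS _ Sp.
have [u0 Au0 u0p] : (phi' @` A) (phi u).
  by rewrite im; split=> //; case: Nn.
have dphi' : differentiable phi' u0 by exact: (smo [::] u0 Au0).
set T := 'd phi' u0; set D := 'd phi u.
have [C C0 CP] := @injective_linear_bounded_below _ _ T (inj' _ Au0).
(* lam detects the image of T: linear forms that vanish on it *)
have [lam [lamT lamP]] : exists lam : {linear 'rV[R]_n -> 'rV[R]_n},
    (forall k, lam (T k) = 0) /\ (forall x, lam x = 0 -> (x <= lin1_mx T)%MS).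
  exists (mulmxr (cokermx (lin1_mx T))); split=> [k|x /= x0].
    by rewrite /= -mul_rV_lin1 -mulmxA mulmx_coker mulmx0.
  by rewrite submxE; apply/eqP.
have [K K0 KP] := linear_bounded lam.
have [M M0 MP] := linear_bounded D.
have Nphi : \forall w \near u, N (phi w).
  apply: near_fun; last exact: open_nbhs_nbhs.
  exact: differentiable_continuous dphi.
have lift : psi' (phi w) @[w --> u] --> u0.
  have /(_ (phi u)) := (subspace_continuousP (S `&` N) psi').1 psic.
  rewrite -{3}u0p psiK // => /(_ _) psi_cvg.
  apply: cvg_comp (psi_cvg _); last by split=> //; case: Nn.
  move=> P /= AP; have : \forall w \near u, S (phi w) -> N (phi w) -> P (phi w).
    apply: (@near_fun _ _ phi u (fun y => S y -> N y -> P y)).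
      exact: differentiable_continuous dphi.
    by move: AP; rewrite /within /=; apply: filterS => y Py Sy Ny; exact: Py.
  move=> SNP; near=> w; rewrite /=; near: w; apply: filterS3 SNP Sphi Nphi.
  by move=> w SNP Sw Nw; exact: SNP.
have liftK : \forall w \near u, phi' (psi' (phi w)) = phi w.
  near=> w; have [v Av vw] : (phi' @` A) (phi w).
    by rewrite im; split; [near: w|near: w].
  by rewrite -vw psiK.
have lamD (e : R) : 0 < e ->
    \forall w \near u, `|lam (D (w - u))| <= e * `|w - u|.
  move=> e0.
  have c0 : 0 < 4 * K * C * (M + 1) by rewrite !mulr_gt0 // addr_gt0.
  (* C * e1 <= 1/2 makes the lift Lipschitz with constant 2 * C; the errors e1
     of phi' and e2 of phi then each contribute at most e / 2 *)
  pose e1 : R := Num.min (2 * C)^-1 (e / (4 * K * C * (M + 1))).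
  pose e2 : R := Num.min 1 (e / (2 * K)).
  have e10 : 0 < e1 by rewrite lt_min invr_gt0 mulr_gt0 // divr_gt0.
  have e20 : 0 < e2 by rewrite lt_min ltr01 divr_gt0 // mulr_gt0.
  have Ce1 : C * e1 <= 1 / 2.
    rewrite (@le_trans _ _ (C * (2 * C)^-1)) ?ler_pM2l ?ge_min ?lexx //.
    by rewrite invfM mulrCA divff ?gt_eqF // mul1r mulr1.
  have Ke2 : K * e2 <= e / 2.
    rewrite (@le_trans _ _ (K * (e / (2 * K)))) ?ler_pM2l ?ge_min ?lexx ?orbT //.
    by rewrite le_eqVlt; apply/orP; left; apply/eqP; field; rewrite gt_eqF.
  have Ke1 : 2 * K * C * e1 * (M + 1) <= e / 2.
    have : e1 * (4 * K * C * (M + 1)) <= e.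
      by rewrite -ler_pdivlMr // /e1 ge_min lexx orbT.
    lra.
  have e21 : e2 <= 1 by rewrite ge_min lexx.
  have near1 : \forall w \near u, `|phi' (psi' (phi w)) - phi' u0 -
      T (psi' (phi w) - u0)| <= e1 * `|psi' (phi w) - u0|.
    exact: lift _ (diff_approx dphi' e10).
  have near2 := diff_approx dphi e20.
  apply: filterS3 near1 near2 liftK => w /=; set v := psi' (phi w) => H1 H2 vw.
  rewrite vw u0p in H1; set q := phi w - phi u in H1 H2.
  have vq : `|v - u0| <= 2 * C * `|q|.
    have : `|v - u0| <= C * (`|q| + e1 * `|v - u0|).
      rewrite (le_trans (CP _)) // ler_pM2l //.
      rewrite -[T _ in leLHS](subKr q) (le_trans (ler_normB _ _)) // lerD2l.
      by [].
    have := ler_wpM2r (normr_ge0 (v - u0)) Ce1; lra.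
  have qw : `|q| <= (M + 1) * `|w - u|.
    rewrite -[q](subrK (D (w - u))) (le_trans (ler_normD _ _)) // addrC mulrDl.
    by rewrite lerD // (le_trans H2) // ler_wpM2r.
  have lamq : `|lam q| <= 2 * K * C * e1 * (M + 1) * `|w - u|.
    rewrite -[q](subrK (T (v - u0))) linearD lamT addr0 (le_trans (KP _)) //.
    rewrite (@le_trans _ _ (K * (e1 * (2 * C * ((M + 1) * `|w - u|))))) //.
      rewrite ler_pM2l // (le_trans H1) // ler_pM2l // (le_trans vq) //.
      by rewrite ler_pM2l // mulr_gt0.
    by rewrite le_eqVlt; apply/orP; left; apply/eqP; ring.
  rewrite -[D _](subKr q) (linearB lam) (le_trans (ler_normB _ _)) //.
  have H3 : `|lam (q - D (w - u))| <= K * (e2 * `|w - u|).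
    by rewrite (le_trans (KP _)) // ler_pM2l.
  have := ler_wpM2r (normr_ge0 (w - u)) Ke1.
  have := ler_wpM2r (normr_ge0 (w - u)) Ke2.
  lra.
have lamD0 h : lam (D h) = 0.
  apply/eqP; rewrite -normr_le0; apply/ler_addgt0Pr => e e0; rewrite add0r.
  have h1 : 0 < `|h| + 1 by rewrite ltr_wpDl.
  have near0 := lamD _ (divr_gt0 e0 h1).
  have cvu : u + t *: h @[t --> (0 : R)] --> u.
    rewrite -[X in _ --> X]addr0 -(scale0r h); apply: cvgD; first exact: cvg_cst.
    exact: cvgZr_tmp.
  have /nbhs_ballP[r r0 rP] := cvu _ near0.
  have r2 : 0 < r / 2 by exact: divr_gt0.
  have rr : ball (0 : R) r (r / 2).
    by rewrite /ball /= sub0r normrN gtr0_norm //; lra.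
  move: (r / 2) r2 rr => s s0 /rP /=.
  rewrite addrAC subrr add0r 2!linearZ !normrZ gtr0_norm //.
  rewrite mulrCA ler_pM2l // => /le_trans; apply.
  by rewrite mulrAC ler_pdivrMr // ler_pM2l // lerDl.
have DT : (lin1_mx D <= lin1_mx T)%MS.
  apply/row_subP => i; rewrite rowE mul_rV_lin1.
  exact/lamP/lamD0.
have := mxrankS DT; rewrite (eqP (injective_row_free injphi)) => /leq_trans.
by apply; exact: rank_leq_row.
Unshelve. all: by end_near. Qed.

End Tangent.

(** * Permutation representations and their invariants *)

Section SymAct.
Variables (R : realType) (n : nat).

Lemma sym_act_linear (s : 'S_n) : linear (fun x : 'rV[R]_n => sym_act x s).
Proof. by move=> a x y; apply/rowP => i; rewrite !mxE. Qed.

Lemma elem_sym_act (x : 'rV[R]_n) (s : 'S_n) :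
  elem_sym (sym_act x s) = elem_sym x.
Proof.
apply/rowP => j; rewrite !mxE.
pose im (t : 'S_n) (A : {set 'I_n}) := (t @: A)%SET.
have imK t : cancel (im t) (im t^-1%g).
  move=> A; rewrite /im -finset.imset_comp.
  by rewrite (eq_imset _ (permK t)) finset.imset_id.
have imKV t : cancel (im t^-1%g) (im t) by move=> A; rewrite -[t in im t _]invgK imK.
rewrite (reindex (im s)); last first.
  by exists (im s^-1%g) => A _; rewrite ?imK ?imKV.
apply: eq_big => [A|A _]; first by rewrite card_imset //; exact: perm_inj.
rewrite big_imset /=; last by move=> ? ? _ _; exact: perm_inj.
by apply: eq_bigr => i _; rewrite sym_actE permK.
Qed.

Lemma norm_sym_act (x : 'rV[R]_n) (s : 'S_n) : `|sym_act x s| = `|x|.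
Proof.
have le y t : `|sym_act y t| <= `|y|.
  by apply: norm_le_coord => // i; rewrite sym_actE coord_le_norm.
by apply/eqP; rewrite eq_le le /= -{1}(sym_actK s x) le.
Qed.

End SymAct.

(** The setting shared by S_n acting on R^n and W(U) acting on U: a group acting on
    a space embedded in R^n, in which every element permutes coordinates. *)
Section PermutationRepresentation.
Variables (R : realType) (n : nat) (V : vectType R).
Variables (gT : finGroupType) (G : {group gT}) (to : action G V).
Variable iota : {linear V -> 'rV[R]_n}.
Hypothesis iota_inj : injective iota.
Hypothesis iota_perm : forall g, g \in G ->
  exists s : 'S_n, forall x, iota (to x g) = sym_act (iota x) s.

Implicit Types (x y v h : V) (g k : gT).

Lemma act_linear g : g \in G -> linear (fun x => to x g).
Proof.
move=> /iota_perm[s sE] a x y; apply: iota_inj.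
by rewrite linearP !sE linearP sym_act_linear.
Qed.

Lemma actB g x y : g \in G -> to (x - y) g = to x g - to y g.
Proof.
by move=> gG; rewrite addrC -scaleN1r act_linear // scaleN1r addrC.
Qed.

Lemma actMin g k x : g \in G -> k \in G -> to x (g * k)%g = to (to x g) k.
Proof.
by have [_ toM] : is_action G to by [case: to]; move=> gG kG; exact: toM.
Qed.

Lemma act_id x : to x 1%g = x.
Proof.
have [inj _] : is_action G to by case: to.
by apply: (inj 1%g); rewrite -actMin ?group1 // mulg1.
Qed.

Lemma act_invK g x : g \in G -> to (to x g) g^-1%g = x.
Proof. by move=> gG; rewrite -actMin ?groupV // mulgV act_id. Qed.

Lemma act_invKV g x : g \in G -> to (to x g^-1%g) g = x.
Proof. by move=> gG; rewrite -actMin ?groupV // mulVg act_id. Qed.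

Definition nrm x : R := `|iota x|.

Lemma nrm_act g x : g \in G -> nrm (to x g) = nrm x.
Proof. by move=> /iota_perm[s sE]; rewrite /nrm sE norm_sym_act. Qed.

Lemma nrmB x y : nrm (x - y) = nrm (y - x).
Proof. by rewrite /nrm !linearB distrC. Qed.

Lemma nrm_tri y x z : nrm (x - z) <= nrm (x - y) + nrm (y - z).
Proof. by rewrite /nrm !linearB ler_distD. Qed.

Lemma nrm_gt0 x : (0 < nrm x) = (x != 0).
Proof. by rewrite normr_gt0 raddf_eq0. Qed.

Lemma elem_sym_act_in g x :
  g \in G -> elem_sym (iota (to x g)) = elem_sym (iota x).
Proof. by move=> /iota_perm[s ->]; exact: elem_sym_act. Qed.

(** The invariant inner product inherited from the ambient space. *)
Definition dot x y : R := \sum_i iota x 0 i * iota y 0 i.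

Definition sqn x : R := dot x x.

Lemma dot_linear x : linear (dot x : V -> R^o).
Proof.
move=> a y z; rewrite /dot scaler_sumr -big_split; apply: eq_bigr => i _.
by rewrite linearP !mxE mulrDr /= /GRing.scale /=; ring.
Qed.

Lemma sqn_act g x : g \in G -> sqn (to x g) = sqn x.
Proof.
move=> /iota_perm[s sE]; rewrite /sqn /dot sE.
rewrite (reindex_inj (@perm_inj _ s)); apply: eq_bigr => i _.
by rewrite sym_actE permK.
Qed.

Lemma sqn_ge0 x : 0 <= sqn x.
Proof. by apply: sumr_ge0 => i _; rewrite -expr2 sqr_ge0. Qed.

Lemma sqr_nrm_le x : nrm x ^+ 2 <= sqn x.
Proof.
have [s0|s0] := eqVneq (nrm x) 0; first by rewrite s0 expr0n /= sqn_ge0.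
have q0 := sqn_ge0 x.
rewrite -[leRHS]sqr_sqrtr // ler_sqr ?nnegrE ?sqrtr_ge0 ?normr_ge0 //.
apply: norm_le_coord => [|i]; first exact: sqrtr_ge0.
rewrite -sqrtr_sqr ler_sqrt // /sqn /dot (bigD1 i) //= expr2 lerDl.
by apply: sumr_ge0 => j _; rewrite -expr2 sqr_ge0.
Qed.

Lemma sqn0 : sqn 0 = 0.
Proof. by rewrite /sqn /dot big1 // => i _; rewrite linear0 mxE mul0r. Qed.

Lemma sqn_gt0 x : (0 < sqn x) = (x != 0).
Proof.
apply/idP/idP => [|x0].
  by apply: contraTneq => ->; rewrite sqn0 ltxx.
by apply: lt_le_trans (sqr_nrm_le x); rewrite exprn_gt0 ?nrm_gt0.
Qed.

Lemma poly_fun_dot h v : poly_fun (fun x => dot h (x - v)).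
Proof.
rewrite (_ : (fun x => _) = fun x => dot h x - dot h v).
  apply: gen_algebra_sub; last exact: gen_algebra_cst.
  exact/poly_fun_linear/dot_linear.
apply/funext => x; rewrite addrC -[- v]scaleN1r (dot_linear h) scaleN1r.
by rewrite addrC.
Qed.

Lemma poly_fun_iota v i : poly_fun (fun x => iota (x - v) 0 i).
Proof.
rewrite (_ : (fun x => _) = fun x => iota x 0 i - iota v 0 i).
  apply: gen_algebra_sub; last exact: gen_algebra_cst.
  by apply: poly_fun_linear => a x y; rewrite linearP !mxE.
by apply/funext => x; rewrite linearB !mxE.
Qed.

Lemma poly_fun_sqn v : poly_fun (fun x => sqn (x - v)).
Proof.
by apply: gen_algebra_sum => i _; apply: gen_algebra_mul; exact: poly_fun_iota.
Qed.

Lemma poly_fun_act f g : g \in G -> poly_fun f -> poly_fun (fun x => f (to x g)).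
Proof.
move=> gG; pose aM := GRing.isLinear.Build R V V *:%R _ (act_linear gG).
pose aL : {linear V -> V} := HB.pack (fun x => to x g) aM.
exact: (poly_fun_comp_linear aL).
Qed.

(** * Isotropy groups and fixed spaces *)

Lemma isotropyP g x : reflect (g \in G /\ to x g = x) (g \in isotropy to x).
Proof. by rewrite inE; apply: (iffP andP) => -[gG /eqP]. Qed.

Lemma isotropy_group_set x : group_set (isotropy to x).
Proof.
apply/group_setP; split=> [|g k /isotropyP[gG gx] /isotropyP[kG kx]].
  by apply/isotropyP; rewrite group1 act_id.
by apply/isotropyP; rewrite groupM // actMin // gx.
Qed.

Canonical isotropy_group x := Group (isotropy_group_set x).

Lemma isotropy_sub x : isotropy to x \subset G.
Proof. by apply/fintype.subsetP => g /isotropyP[]. Qed.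

Lemma isotropy_act x g : g \in G -> isotropy to (to x g) = (isotropy to x :^ g)%g.
Proof.
move=> gG; apply/setP => k; rewrite mem_conjg; apply/isotropyP/isotropyP.
  move=> [kG kx]; rewrite memJ_norm ?(fintype.subsetP (normG G)) ?groupV //.
  split=> //; rewrite conjgE invgK mulgA !actMin ?groupM ?groupV //.
  by rewrite kx act_invK.
rewrite memJ_norm ?(fintype.subsetP (normG G)) ?groupV // => -[kG kx].
split=> //; move: kx; rewrite conjgE invgK mulgA !actMin ?groupM ?groupV //.
by move=> /(congr1 (to^~ g)); rewrite act_invKV.
Qed.

Definition fixv (A : {set gT}) : {vspace V} :=
  (\bigcap_(g in A) lker (linfun (fun x => (to x g - x)%R)))%VS.

Lemma fixvP (A : {set gT}) x : A \subset G ->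
  reflect (forall g, g \in A -> to x g = x) (x \in fixv A).
Proof.
move=> AG.
have lin g : g \in A -> x \in lker (linfun (fun x => to x g - x)) <-> to x g = x.
  move=> gA; have gG := fintype.subsetP AG g gA.
  have lg : linear (fun x => to x g - x).
    by move=> a y z; rewrite act_linear // scalerBr opprD addrACA.
  pose aM := GRing.isLinear.Build R V V *:%R _ lg.
  pose aL : {linear V -> V} := HB.pack (fun x => to x g - x) aM.
  rewrite memv_ker -[linfun _]/(linfun aL) lfunE /= subr_eq0.
  by split=> [/eqP|->].
rewrite /fixv; apply: (iffP idP) => [|xA].
  move=> xA g gA; apply/(lin g gA); move: xA; rewrite memvE => /subv_bigcapP.
  by move=> /(_ g gA); rewrite -memvE.
rewrite memvE; apply/subv_bigcapP => g gA; rewrite -memvE.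
exact/(lin g gA)/xA.
Qed.

Lemma mem_fixv_isotropy x : x \in fixv (isotropy to x).
Proof. by apply/fixvP => [|g /isotropyP[]//]; exact: isotropy_sub. Qed.

(** The dimension that the orbit type stratum of x will turn out to have. *)
Definition type_dim x : nat := \dim (fixv (isotropy to x)).

Definition gap x (d : R) :=
  0 < d /\ forall g, g \in G -> nrm (to x g - x) < d -> to x g = x.

Lemma isotropy_gap x : exists d : R, gap x d.
Proof.
have small : \forall d \near 0^'+, forall g,
    g \in G -> nrm (to x g - x) < d -> to x g = x.
  apply: filter_forall => g.
  have [->|gx] := eqVneq (to x g) x; first exact: nearW.
  have g0 : 0 < nrm (to x g - x) by rewrite nrm_gt0 subr_eq0.
  near=> d => _ /ltW; rewrite leNgt => /negP[].
  by near: d; exact: nbhs_right_lt.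
have pos : \forall d \near 0^'+, (0 : R) < d by exact: nbhs_right_gt.
by have [d [d0 dP]] := filter_ex (filterI pos small); exists d.
Unshelve. all: by end_near. Qed.

(** Isotropy groups are upper semicontinuous: an element fixing v moves a
    nearby point x by less than the gap at x. *)
Lemma isotropy_near x d v : gap x d -> nrm (v - x) < d / 2 ->
  isotropy to v \subset isotropy to x.
Proof.
move=> [_ dP] vx; apply/fintype.subsetP => g /isotropyP[gG gv]; apply/isotropyP.
split=> //; apply: dP => //; rewrite (le_lt_trans (nrm_tri v _ _)) //.
by rewrite -{1}gv -actB // nrm_act // [d]splitr nrmB ltrD.
Qed.

Lemma dim_fixv_conj (A : {set gT}) g : A \subset G -> g \in G ->
  \dim (fixv (A :^ g)%g) = \dim (fixv A).
Proof.
have le (B : {set gT}) k : B \subset G -> k \in G ->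
    (\dim (fixv (B :^ k)%g) <= \dim (fixv B))%N.
  move=> BG kG; pose aM := GRing.isLinear.Build R V V *:%R _ (act_linear kG).
  pose aL : {linear V -> V} := HB.pack (fun x => to x k) aM.
  have BkG : (B :^ k \subset G)%g by rewrite -(conjGid kG) conjSg.
  apply: (@leq_trans (\dim (linfun aL @: fixv B)%VS)).
    apply/dimvS/subvP => x xB; rewrite -(act_invKV x kG).
    have -> : to (to x k^-1%g) k = linfun aL (to x k^-1%g) by rewrite lfunE.
    apply/memv_img/fixvP => // b bB; have bG := fintype.subsetP BG b bB.
    have kVG : k^-1%g \in G by rewrite groupV.
    have bkB : (b ^ k)%g \in (B :^ k)%g by rewrite memJ_conjg.
    have := fixvP _ BkG xB _ bkB; rewrite conjgE !actMin ?groupM //.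
    by move=> /(congr1 (to^~ k^-1%g)); rewrite act_invK.
  by rewrite -(limg_ker_dim (linfun aL) (fixv B)) leq_addl.
move=> AG gG; apply/eqP; rewrite eqn_leq le //=.
rewrite -{1}(conjsgK g A) le ?groupV //.
by rewrite -(conjGid gG) conjSg.
Qed.

(** * Separation of orbits by invariants *)

Section Generated.
Hypothesis gen : forall f, invariant_poly to f ->
  gen_algebra [set f | exists i : 'I_n, f = fun x => elem_sym (iota x) 0 i] f.

Lemma invariant_factor f : invariant_poly to f ->
  exists2 P : 'rV[R]_n -> R, poly_fun P & forall x, f x = P (elem_sym (iota x)).
Proof.
move=> /gen; elim=> {f} [a|_ [i ->]|f g _ [P pP fP] _ [Q pQ gQ]
  |f g _ [P pP fP] _ [Q pQ gQ]].
- by exists (fun=> a) => //; exact: gen_algebra_cst.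
- by exists (fun z => z 0 i) => //; exact: poly_fun_coord.
- exists (fun z => P z + Q z) => [|x]; first exact: gen_algebra_add.
  by rewrite fP gQ.
- exists (fun z => P z * Q z) => [|x]; first exact: gen_algebra_mul.
  by rewrite fP gQ.
Qed.

(** The product of the squared distances to the points of an orbit is an
    invariant which is small only close to the orbit. *)
Lemma orbit_polynomial v : exists2 P : 'rV[R]_n -> R, poly_fun P &
  forall x, \prod_(g in G) sqn (x - to v g) = P (elem_sym (iota x)).
Proof.
apply: invariant_factor; split.
  by apply: gen_algebra_prod => g _; exact: poly_fun_sqn.
move=> k x kG; rewrite (reindex_inj (mulIg k)) /=.
apply: eq_big => [g|g gG]; first by rewrite groupMr.
by rewrite groupMr // in gG; rewrite actMin // -actB // sqn_act.
Qed.

Lemma prod_sqn_orbit0 v : \prod_(g in G) sqn (v - to v g) = 0.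
Proof.
by rewrite (bigD1 1%g) ?group1 //= act_id subrr sqn0 mul0r.
Qed.

Lemma sigma_eq_orbit x v : elem_sym (iota x) = elem_sym (iota v) ->
  exists2 g, g \in G & x = to v g.
Proof.
move=> xv; have [P _ PE] := orbit_polynomial v.
have /eqP : \prod_(g in G) sqn (x - to v g) = 0.
  by rewrite PE xv -PE prod_sqn_orbit0.
rewrite prodf_seq_eq0 => /hasP[g _ /andP[gG]] /eqP xg; exists g => //.
apply/eqP; rewrite -subr_eq0; apply: contraT; rewrite -sqn_gt0 xg.
by rewrite ltxx.
Qed.

(** Openness of the orbit map onto its image, in the form in which the charts of
    the strata use it: the sublevel sets of the orbit polynomial are the
    neighbourhoods. *)
Lemma sigma_separates v (e : R) : 0 < e ->
  exists N : set 'rV[R]_n, open_nbhs (elem_sym (iota v)) N /\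
    forall x, N (elem_sym (iota x)) ->
      exists2 g, g \in G & nrm (x - to v g) < e.
Proof.
move=> e0; have [P pP PE] := orbit_polynomial v.
pose c := (e ^+ 2) ^+ #|G|.
have c0 : 0 < c by rewrite !exprn_gt0.
exists (P @^-1` [set z | z < c]); split.
  split; last by rewrite /= -PE prod_sqn_orbit0.
  apply: open_comp; last exact: open_lt.
  by move=> z _; exact: poly_fun_continuous.
move=> x /=; rewrite -PE => fx; apply: contrapT => xfar.
move: fx; rewrite ltNge => /negP; apply.
rewrite /c -prodr_const; apply: ler_prod => g gG; rewrite sqr_ge0 /=.
apply: le_trans (sqr_nrm_le _); rewrite ler_sqr ?nnegrE ?normr_ge0 ?(ltW e0) //.
by rewrite leNgt; apply/negP => xg; apply: xfar; exists g.
Qed.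

Lemma sigma_line_continuous x h :
  continuous (fun t : R => elem_sym (iota (x + t *: h))).
Proof.
move=> t; have lc : iota (x + s *: h) @[s --> t] --> iota (x + t *: h).
  rewrite linearD linearZ; under eq_fun do rewrite linearD linearZ.
  by apply: cvgD; [exact: cvg_cst|apply: cvgZr_tmp].
have Ex : {for iota (x + t *: h), continuous (@elem_sym R n)}.
  apply: differentiable_continuous; apply: poly_map_differentiable.
  exact: poly_fun_elem_sym.
exact: (cvg_comp _ _ lc Ex).
Qed.

(** A direction fixed by the isotropy group of x is detected to first order by an
    invariant: average over the group the polynomial y |-> <h, y - x> damped by
    the squared distances to the other points of the orbit of x. *)
Lemma sigma_immersive x h : h \in fixv (isotropy to x) -> h != 0 ->
  exists2 c : R, 0 < c & \forall t \near (0 : R),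
    c * `|t| <= `|elem_sym (iota (x + t *: h)) - elem_sym (iota x)|.
Proof.
move=> hx h0; set H := isotropy to x.
have HG : H \subset G := isotropy_sub x.
pose q y := dot h (y - x) * \prod_(g in G :\: H) sqn (y - to x g).
pose F y := \sum_(k in G) q (to y k).
have polyq : poly_fun q.
  apply: gen_algebra_mul; first exact: poly_fun_dot.
  by apply: gen_algebra_prod => g _; exact: poly_fun_sqn.
have [|P pP FP] := @invariant_factor F.
  split.
    by apply: gen_algebra_sum => k kG; exact: poly_fun_act polyq.
  move=> k y kG; rewrite /F [RHS](reindex_inj (mulgI k)) /=.
  apply: eq_big => [g|g gG]; first by rewrite groupMl.
  by rewrite actMin.
(* Along the line F (x + t h) is t f1 + t^2 f2: elements of H fix the line and
   contribute t each, any other k contributes the factor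
   |k (x + t h) - k x|^2 = t^2 |h|^2. *)
pose f1 y := \sum_(k in H) (sqn h * \prod_(g in G :\: H) sqn (y - to x g)).
pose f2 y := \sum_(k in G :\: H) (dot h (to y k - x) * sqn h *
  \prod_(g in (G :\: H) :\ k) sqn (to y k - to x g)).
have pf1 : poly_fun f1.
  apply: gen_algebra_sum => k _; apply: gen_algebra_mul.
    exact: gen_algebra_cst.
  by apply: gen_algebra_prod => g _; exact: poly_fun_sqn.
have pf2 : poly_fun f2.
  apply: gen_algebra_sum => k /setDP[kG _]; apply: gen_algebra_mul.
    apply: gen_algebra_mul; last exact: gen_algebra_cst.
    by have := poly_fun_act kG (poly_fun_dot h x).
  apply: gen_algebra_prod => g _.
  by have := poly_fun_act kG (poly_fun_sqn (to x g)).
have Fline t : F (x + t *: h) = t * (f1 (x + t *: h) + t * f2 (x + t *: h)).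
  rewrite /F (big_setID H) /= (finset.setIidPr HG) mulrDr /f1 /f2 !mulr_sumr.
  congr (_ + _); apply: eq_bigr => k.
    move=> kH; have kG := fintype.subsetP HG k kH.
    have -> : to (x + t *: h) k = x + t *: h.
      rewrite addrC act_linear // (fixvP _ HG hx) //.
      by have /isotropyP[_ ->] := kH.
    rewrite /q mulrA addrAC subrr add0r; congr (_ * _).
    by have := dot_linear h t h 0; rewrite addr0 => ->;
      rewrite /dot [X in _ + X]big1 ?addr0 // => i _; rewrite linear0 mxE mulr0.
  move=> kGH; have kG : k \in G by case/setDP: kGH.
  rewrite /q (big_setD1 k) //=.
  have -> : sqn (to (x + t *: h) k - to x k) = t * t * sqn h.
    rewrite -actB // sqn_act // addrAC subrr add0r /sqn /dot mulr_sumr.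
    by apply: eq_bigr => i _; rewrite linearZ mxE; ring.
  by ring.
have f10 : 0 < f1 x.
  rewrite /f1 sumr_const pmulrn_lgt0; last first.
    by apply/card_gt0P; exists 1%g; exact: group1.
  rewrite mulr_gt0 ?sqn_gt0 // prodr_gt0 // => g /setDP[gG gH].
  rewrite sqn_gt0 subr_eq0; apply: contraNneq gH => xg.
  by apply/isotropyP.
have [p1 p1E] := poly_fun_line x h pf1.
have [p2 p2E] := poly_fun_line x h pf2.
pose p := p1 + 'X * p2.
have pE t : F (x + t *: h) = t * p.[t].
  by rewrite Fline p1E p2E /p hornerD hornerM hornerX.
have p0 : p.[0] = f1 x.
  by rewrite /p hornerD hornerM hornerX mul0r addr0 -p1E scale0r addr0.
pose E t := elem_sym (iota (x + t *: h)).
have Ec : E t @[t --> (0 : R)] --> E 0 by exact: sigma_line_continuous.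
have E0 : E 0 = elem_sym (iota x) by rewrite /E scale0r addr0.
have [L L0 LP] := poly_fun_bounded_lipschitz (`|E 0| + 1) pP.
exists (f1 x / 2 / L); first by rewrite !divr_gt0.
have Fx0 : P (E 0) = 0.
  by rewrite /E -FP pE mul0r.
near=> t.
have pt : f1 x / 2 <= `|p.[t]|.
  apply: le_trans (ler_norm _); near: t; rewrite -p0.
  apply: (@cvgr_ge _ _ _ _ (horner p) p.[0] _); first exact: continuous_horner.
  by rewrite p0; lra.
have Et : `|E t| <= `|E 0| + 1.
  rewrite -lerBlDl (le_trans (lerB_dist _ _)) // distrC.
  by near: t; move/cvgrPdist_le: Ec => /(_ _ ltr01).
have E0B : `|E 0| <= `|E 0| + 1 by rewrite lerDl.
have [_ ] := LP _ _ Et E0B; rewrite Fx0 subr0 {1}/E -FP pE normrM => H1.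
rewrite -E0 -/(E t) mulrAC ler_pdivrMr // mulrC [leRHS]mulrC.
apply: le_trans H1.
by rewrite ler_wpM2l.
Unshelve. all: by end_near. Qed.

(** * Orbit type strata *)

Lemma vspace_param (F : {vspace V}) :
  exists B : {linear 'rV[R]_(\dim F) -> V},
    injective B /\ forall x, x \in F <-> exists u, B u = x.
Proof.
pose b := vbasis F; pose Bf (u : 'rV[R]_(\dim F)) := \sum_i u 0 i *: b`_i.
have lB : linear Bf.
  move=> a u w; rewrite /Bf scaler_sumr -big_split; apply: eq_bigr => i _.
  by rewrite !mxE scalerDl scalerA.
pose BM := GRing.isLinear.Build R _ V *:%R Bf lB.
pose B : {linear 'rV[R]_(\dim F) -> V} := HB.pack Bf BM.
have bb : basis_of F b := vbasisP F.
exists B; split=> [u w uw|x].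
  apply/rowP => i; apply/eqP; rewrite -subr_eq0; apply/eqP.
  have /freeP/(_ (fun i => u 0 i - w 0 i)) := basis_free bb; apply.
  under eq_bigr do rewrite scalerBl.
  by rewrite sumrB; apply/eqP; rewrite subr_eq0; apply/eqP.
split=> [xF|[u <-]]; last first.
  by apply: memv_suml => i _; rewrite memvZ // vbasis_mem // mem_nth ?size_tuple.
exists (\row_i coord b i x); rewrite /= /Bf [RHS](coord_vbasis xF).
by apply: eq_bigr => i _; rewrite mxE.
Qed.

Lemma isotropy_eq_near x d w : gap x d -> w \in fixv (isotropy to x) ->
  nrm (w - x) < d / 2 -> isotropy to w = isotropy to x.
Proof.
move=> gx wF wx; apply/eqP; rewrite finset.eqEsubset (isotropy_near gx wx) /=.
apply/fintype.subsetP => g xg; have /isotropyP[gG _] := xg; apply/isotropyP.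
by split=> //; exact: (fixvP _ (isotropy_sub x) wF).
Qed.

Lemma isotropy_type_self x : isotropy_type to (isotropy_group x) x.
Proof. by exists 1%g; rewrite ?group1 // conjsg1. Qed.

Definition stratum_of x : set 'rV[R]_n :=
  connected_component
    ((fun y => elem_sym (iota y)) @` isotropy_type to (isotropy_group x))
    (elem_sym (iota x)).

(** The segment from x to w consists of points with the isotropy group of x, so
    its image is connected inside the image of one isotropy type. *)
Lemma stratum_of_near x d w : gap x d -> w \in fixv (isotropy to x) ->
  nrm (w - x) < d / 2 -> stratum_of x (elem_sym (iota w)).
Proof.
move=> gx wF wx.
pose path (t : R) := elem_sym (iota (x + t *: (w - x))).
have cpath : continuous path by move=> t; exact: sigma_line_continuous.
have conn : connected (path @` `[0, 1]).
  apply: connected_continuous_connected; first exact: segment_connected.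
  exact: continuous_subspaceT.
apply: (connected_component_max (B := path @` `[0, 1])) => //.
- by exists 0; rewrite /= ?in_itv /= ?lexx ?ler01 // /path scale0r addr0.
- move=> _ [t /= t01 <-]; exists (x + t *: (w - x)) => //.
  exists 1%g; rewrite ?group1 // conjsg1; apply: (isotropy_eq_near gx).
    have xF := mem_fixv_isotropy x.
    by rewrite memvD // memvZ // memvB.
  move: t01; rewrite in_itv /= => /andP[t0 t1].
  rewrite addrAC subrr add0r /nrm linearZ normrZ ger0_norm //.
  by apply: le_lt_trans wx; rewrite ler_piMl.
- by exists 1; rewrite /= ?in_itv /= ?lexx ?ler01 // /path scale1r addrC subrK.
Qed.

Lemma sigma_poly_map d (B : {linear 'rV[R]_d -> V}) :
  poly_map (fun w => elem_sym (iota (B w))).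
Proof.
move=> j; have := @poly_fun_elem_sym R n j.
apply: (@gen_algebra_comp _ _ _ _ _ (iota \o B)).
by move=> _ [l ->]; apply: poly_fun_linear => a u w; rewrite /= !linearP.
Qed.

(** A kernel direction of the differential would move the orbit map by o(t),
    against the linear lower bound of the immersion lemma. *)
Lemma chart_injective_diff d (B : {linear 'rV[R]_d -> V}) u : injective B ->
  (forall w, B w \in fixv (isotropy to (B u))) ->
  injective ('d (fun w => elem_sym (iota (B w))) u).
Proof.
move=> injB Bfix; set phi := fun w => _.
have dphi : differentiable phi u.
  exact/poly_map_differentiable/sigma_poly_map.
suff ker0 (h : 'rV[R]_d) : 'd phi u h = 0 -> h = 0.
  move=> w1 w2 /eqP; rewrite -subr_eq0 -linearB => /eqP /ker0 /eqP.
  by rewrite subr_eq0 => /eqP.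
move=> dh; apply/eqP/negPn/negP => h0.
have Bh0 : B h != 0.
  by rewrite raddf_eq0.
have [c c0 cP] := sigma_immersive (Bfix h) Bh0.
have nh : 0 < `|h| + 1 by rewrite ltr_wpDl.
have e0 : 0 < c / 2 / (`|h| + 1) by rewrite !divr_gt0.
have /nbhs_ballP[r r0 rP] := diff_approx dphi e0.
have /nbhs_ballP[s s0 sP] := cP.
pose t := Num.min (r / (`|h| + 1) / 2) (s / 2).
have t0 : 0 < t by rewrite lt_min !divr_gt0.
have tr : t * (`|h| + 1) < r.
  rewrite -ltr_pdivlMr // /t gt_min; apply/orP; left.
  by rewrite gtr_pMr ?divr_gt0 // invf_lt1 // ltr1n.
have ts : t < s.
  rewrite /t gt_min; apply/orP; right.
  by rewrite gtr_pMr // invf_lt1 // ltr1n.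
have : ball u r (u + t *: h).
  rewrite -ball_normE /= opprD addrA subrr add0r normrN normrZ gtr0_norm //.
  by apply: le_lt_trans tr; rewrite ler_pM2l // lerDl.
have uth : u + t *: h - u = t *: h by rewrite addrAC subrr add0r.
move/rP; rewrite /= uth linearZ /= dh scaler0 subr0 /phi.
have : ball (0 : R) s t by rewrite -ball_normE /= sub0r normrN gtr0_norm.
have -> : B (u + t *: h) = B u + t *: B h by rewrite linearD linearZ.
move/sP => /= /le_trans /[apply].
rewrite normrZ gtr0_norm // mulrCA mulrC ler_pM2l //.
rewrite mulrAC ler_pdivlMr // => H.
have : c * (`|h| + 1) <= c * (`|h| / 2) by lra.
by rewrite ler_pM2l //; have := normr_ge0 h; lra.
Qed.

Lemma near_nrm d (B : {linear 'rV[R]_d -> V}) u (e : R) : 0 < e ->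
  \forall w \near u, nrm (B w - B u) < e.
Proof.
move=> e0; have Bc : {for u, continuous (iota \o B)}.
  apply: differentiable_continuous; apply: poly_map_differentiable.
  exact: linear_poly_map (iota \o B).
move/cvgrPdist_lt: Bc => /(_ _ e0); apply: filterS => w /=.
by rewrite /nrm distrC linearB.
Qed.

(** The orbit map immerses a neighbourhood of x in its fixed space into the
    stratum of x. *)
Lemma type_dim_le_stratum x d :
  submanifold d (stratum_of x) -> (type_dim x <= d)%N.
Proof.
move=> man; have [B [injB BF]] := vspace_param (fixv (isotropy to x)).
have [u ux] := (BF x).1 (mem_fixv_isotropy x).
apply: (submanifold_dim_ge (phi := fun w => elem_sym (iota (B w)))
  (u := u)) man _ _ _.
- exact/poly_map_differentiable/sigma_poly_map.
- by apply: chart_injective_diff => // w; rewrite ux; apply/BF; exists w.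
- have [d0 gx] := isotropy_gap x.
  have d2 : 0 < d0 / 2 by case: gx => d00 _; exact: divr_gt0.
  apply: filterS (near_nrm B u d2) => w; rewrite ux => wx.
  by apply: (stratum_of_near gx) => //; apply/BF; exists w.
Qed.

(** Near x the orbit map restricted to the fixed space of the isotropy group of x
    is injective, because two nearby points of one orbit differ by an element
    that moves x too little not to fix it. *)
Lemma near_orbit_eq x d v w g : gap x d -> v \in fixv (isotropy to x) ->
  g \in G -> nrm (v - x) < d / 4 -> nrm (w - x) < d / 4 ->
  nrm (w - to v g) < d / 4 -> to v g = v.
Proof.
move=> [d0 dP] vF gG vx wx wv.
have gx : to x g = x.
  apply: dP => //; apply: le_lt_trans (nrm_tri (to v g) _ _) _.
  rewrite -actB // nrm_act // nrmB.
  have := nrm_tri w (to v g) x; rewrite (nrmB (to v g) w).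
  by move: vx wx wv; lra.
by apply: (fixvP _ (isotropy_sub x) vF); apply/isotropyP.
Qed.

(** The chart is the orbit map on the fixed space of the isotropy group of x.  It
    reaches every point of the stratum near sigma x: such a point has a preimage
    v' near x, whose isotropy group is contained in that of x and conjugate to it,
    hence equal to it, so that v' lies in the fixed space. *)
Lemma stratum_submanifold_at x :
  exists (O : set 'rV[R]_(type_dim x)) (N : set 'rV[R]_n)
    (phi : 'rV[R]_(type_dim x) -> 'rV[R]_n)
    (psi : 'rV[R]_n -> 'rV[R]_(type_dim x)),
  [/\ open O /\ open_nbhs (elem_sym (iota x)) N,
      smooth_on O phi,
      forall u, O u -> injective ('d phi u),
      phi @` O = stratum_of x `&` N &
      (forall u, O u -> psi (phi u) = u) /\
      {within stratum_of x `&` N, continuous psi}].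
Proof.
have [B [injB BF]] := vspace_param (fixv (isotropy to x)).
have [d gx] := isotropy_gap x; have [d0 dP] := gx.
have d4 : 0 < d / 4 by exact: divr_gt0.
have d42 (r : R) : r < d / 4 -> r < d / 2 by move=> rd; lra.
have [N [Nx NP]] := sigma_separates x d4.
pose phi u := elem_sym (iota (B u)).
have phic : continuous phi.
  move=> u; apply: differentiable_continuous.
  exact/poly_map_differentiable/sigma_poly_map.
pose O1 := [set u | nrm (B u - x) < d / 4 /\ N (phi u)].
have BFix u : B u \in fixv (isotropy to x) by apply/BF; exists u.
(* both injectivity and continuity of the inverse come from this estimate *)
have close w (e : R) : O1 w -> 0 < e -> exists2 N' : set 'rV[R]_n,
    open_nbhs (phi w) N' & forall u, O1 u -> N' (phi u) -> nrm (B u - B w) < e.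
  move=> [wx _] e0; have m0 : 0 < Num.min e (d / 4) by rewrite lt_min e0.
  have [N' [N'w N'P]] := sigma_separates (B w) m0.
  exists N' => // u [ux _] /N'P[g gG]; rewrite lt_min => /andP[ue ud].
  by rewrite -(near_orbit_eq gx (BFix w) gG wx ux ud).
have injphi u w : O1 u -> O1 w -> phi u = phi w -> u = w.
  move=> Ou Ow uw; apply/injB/eqP; rewrite -subr_eq0; apply: contraT => uw0.
  have uw1 : 0 < nrm (B u - B w) by rewrite nrm_gt0.
  have [N' [_ N'w] /(_ u Ou)] := close w _ Ow uw1.
  by rewrite uw ltxx => /(_ N'w).
pose psi z := xget 0 [set u | O1 u /\ phi u = z].
have psiK u : O1 u -> psi (phi u) = u.
  move=> Ou; have : [set w | O1 w /\ phi w = phi u] (psi (phi u)).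
    by apply: xgetPex; exists u.
  by move=> [Ow wu]; exact: injphi.
have im : phi @` O1 = stratum_of x `&` N.
  apply/seteqP; split=> [_ [u [ux uN] <-]|z [Sz Nz]].
    by split=> //; apply: (stratum_of_near gx (BFix u)); exact: d42.
  have [v [k kG vk] vz] := connected_component_sub Sz.
  move: Nz; rewrite -vz => Nv; have [g gG vg] := NP _ Nv.
  have g'G : g^-1%g \in G by rewrite groupV.
  pose v' := to v g^-1%g.
  have v'x : nrm (v' - x) < d / 4.
    by rewrite -(act_invK x gG) -actB // nrm_act.
  have v'H : isotropy to v' = isotropy to x.
    apply/eqP; rewrite eqEcard (isotropy_near gx (d42 _ v'x)) /=.
    by rewrite isotropy_act // vk !cardJg.
  have [u uv'] : exists u, B u = v'.
    by apply/BF; rewrite -v'H mem_fixv_isotropy.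
  exists u; last by rewrite /phi uv' elem_sym_act_in.
  by split; rewrite /phi uv' // elem_sym_act_in.
exists O1, N, phi, psi; split=> //.
- split=> //; rewrite openE => u [ux uN]; rewrite /interior /=.
  have e0 : 0 < d / 4 - nrm (B u - x) by rewrite subr_gt0.
  have Nu : \forall w \near u, N (phi w).
    by apply: near_fun; [exact: phic|case: Nx => oN _; exact: open_nbhs_nbhs].
  apply: filterS2 (near_nrm B u e0) Nu => w wu Nw; split=> //.
  by have := nrm_tri (B u) (B w) x; move: wu; lra.
- exact/poly_map_smooth/sigma_poly_map.
- move=> u [ux _]; apply: chart_injective_diff => // w.
  by rewrite (isotropy_eq_near gx (BFix u) (d42 _ ux)).
- split=> //; apply/(subspace_continuousP (stratum_of x `&` N) psi) => z.
  rewrite -im => -[u0 Ou0 <-].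
  rewrite psiK //; apply/cvgrPdist_lt => e e0.
  have injBi : injective (iota \o B) by exact: inj_comp.
  have [C C0 CP] := injective_linear_bounded_below injBi.
  have [N' N'u N'P] := close u0 (e / C) Ou0 (divr_gt0 e0 C0).
  have := open_nbhs_nbhs N'u; apply: filterS => z' N'z' [u Ou uz'].
  rewrite -uz' in N'z' *; rewrite psiK //.
  apply: le_lt_trans (CP _) _; rewrite mulrC -ltr_pdivlMr //=.
  have := N'P u Ou N'z'; rewrite nrmB /nrm.
  by rewrite !linearB.
Qed.

(** Isotropy types are unions of orbits, so a stratum can be based at any of its
    points, and there at a vector whose isotropy group is H itself rather than a
    conjugate. *)
Lemma component_stratum_of (H : {group gT}) z0 z :
  connected_component ((fun v => elem_sym (iota v)) @` isotropy_type to H) z0 z ->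
  exists v, [/\ isotropy to v = H, elem_sym (iota v) = z &
    connected_component ((fun v => elem_sym (iota v)) @` isotropy_type to H) z0 =
    stratum_of v].
Proof.
move=> Sz; have [v [g gG vg] vz] := connected_component_sub Sz.
have v'H : isotropy to (to v g^-1%g) = H.
  by rewrite isotropy_act ?groupV // vg conjsgK.
have v'z : elem_sym (iota (to v g^-1%g)) = z by rewrite elem_sym_act_in ?groupV.
exists (to v g^-1%g); split=> //.
rewrite /stratum_of (_ : isotropy_group _ = H); last exact/val_inj.
by rewrite v'z; exact: same_connected_component.
Qed.

Lemma stratum_submanifold x : submanifold (type_dim x) (stratum_of x).
Proof.
move=> p /component_stratum_of[v [vx <-]]; rewrite -/(stratum_of x) => ->.
rewrite (_ : type_dim x = type_dim v); first exact: stratum_submanifold_at.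
by rewrite /type_dim vx.
Qed.

(** A stratum could a priori be a submanifold of several dimensions; the lower
    bound on them and the existence of charts make the fixed space dimension the
    smallest one, which is all that membership in a skeleton sees. *)
Lemma skeletonE (s : int) z :
  skeleton to (fun x => elem_sym (iota x)) s z <->
  exists2 x, (type_dim x)%:Z <= s & elem_sym (iota x) = z.
Proof.
split=> [[S [d [[H HG [z0 _ ->]]]]]|[x xs <-]].
  move=> man ds /component_stratum_of[v [_ vz Sv]]; exists v => //.
  by apply: le_trans ds; rewrite lez_nat; apply: type_dim_le_stratum; rewrite -Sv.
have Ex : ((fun v => elem_sym (iota v)) @` isotropy_type to (isotropy_group x))
    (elem_sym (iota x)) by exists x => //; exact: isotropy_type_self.
exists (stratum_of x), (type_dim x); split=> //.
- by exists (isotropy_group x); [exact: isotropy_sub|exists (elem_sym (iota x))].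
- exact: stratum_submanifold.
- exact: connected_component_refl.
Qed.

Lemma skeleton_sigma (s : int) x :
  skeleton to (fun x => elem_sym (iota x)) s (elem_sym (iota x)) <->
  (type_dim x)%:Z <= s.
Proof.
rewrite skeletonE; split=> [[v vs /esym/sigma_eq_orbit[g gG ->]]|xs].
  by rewrite /type_dim isotropy_act // dim_fixv_conj // isotropy_sub.
by exists x.
Qed.

End Generated.

(** * An equation for the low-dimensional strata *)

(** The factor of K vanishes exactly on the fixed space of K.  All subsets K are
    taken, rather than isotropy groups only, so that conjugation visibly permutes
    the factors. *)
Definition lowdim (r : nat) u : R :=
  \prod_(K : {set gT} | (K \subset G) && (\dim (fixv K) < r)%N)
    \sum_(k in K) sqn (to u k - u).

Lemma lowdim_invariant r : invariant_poly to (lowdim r).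
Proof.
split.
  apply: gen_algebra_prod => K /andP[KG _]; apply: gen_algebra_sum => k kK.
  have kG := fintype.subsetP KG k kK.
  apply: gen_algebra_sum => i _.
  have p : poly_fun (fun u => iota (to u k - u) 0 i).
    have lk : linear (fun u => iota (to u k - u) 0 i : R^o).
      by move=> a u w; rewrite act_linear // opprD addrACA -scalerBr linearP !mxE.
    exact: poly_fun_linear lk.
  exact: gen_algebra_mul.
move=> g u gG; have conjG (K : {set gT}) : (K :^ g \subset G)%g = (K \subset G).
  by rewrite -{1}(conjGid gG) conjSg.
rewrite /lowdim (reindex_inj (@conjsg_inj _ g)) /=; apply: eq_big => K.
  by rewrite conjG; case KG: (K \subset G) => //; rewrite dim_fixv_conj.
rewrite conjG => /andP[KG _].
rewrite big_imset /=; last by move=> ? ? _ _; exact: conjg_inj.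
apply: eq_bigr => k kK; have kG := fintype.subsetP KG k kK.
have -> : to (to u g) (k ^ g)%g = to (to u k) g.
  by rewrite -!actMin ?groupJ // conjgE !mulgA mulgV mul1g.
by rewrite -actB // sqn_act.
Qed.

(** Otherwise K would be contained in the isotropy group of u, whose fixed space is
    too large. *)
Lemma type_dim_moves r u (K : {set gT}) : (r <= type_dim u)%N ->
  K \subset G -> (\dim (fixv K) < r)%N -> exists2 k, k \in K & to u k != u.
Proof.
move=> ru KG Kr; apply: contrapT => fixK.
have Ku : K \subset isotropy to u.
  apply/fintype.subsetP => k kK; apply/isotropyP.
  split; first exact: (fintype.subsetP KG).
  by apply/eqP/negPn/negP => ku; apply: fixK; exists k.
have : (fixv (isotropy to u) <= fixv K)%VS.
  apply/subvP => x /(fixvP _ (isotropy_sub u)) xu; apply/fixvP => // k kK.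
  by apply: xu; exact: (fintype.subsetP Ku).
by move=> /dimvS; rewrite leqNgt (leq_trans Kr).
Qed.

Lemma lowdim_gt0 r u : (r <= type_dim u)%N -> 0 < lowdim r u.
Proof.
move=> ru; apply: prodr_gt0 => K /andP[KG Kr].
have [k kK ku] := type_dim_moves ru KG Kr.
rewrite (bigD1 k) //= ltr_wpDr ?sqn_gt0 ?subr_eq0 //.
by apply: sumr_ge0 => *; exact: sqn_ge0.
Qed.

Lemma lowdim_eq0 r u : (type_dim u < r)%N -> lowdim r u = 0.
Proof.
move=> ur; rewrite /lowdim (bigD1 (isotropy to u)) /=; last first.
  by rewrite isotropy_sub.
rewrite [X in X * _]big1 ?mul0r // => k /isotropyP[_ ->].
by rewrite subrr sqn0.
Qed.

(** Away from its zero set the invariant is bounded below by the separation of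
    the distinct coordinates of u: a group element that moves u shifts some
    coordinate by at least this separation. *)
Lemma lowdim_lower_bound r : exists M, forall u (e : R),
  (r <= type_dim u)%N -> 0 <= e ->
  (forall i j, iota u 0 i != iota u 0 j -> e <= `|iota u 0 i - iota u 0 j|) ->
  e ^+ M <= lowdim r u.
Proof.
exists (2 * #|[set K : {set gT} | (K \subset G) && (\dim (fixv K) < r)]%SET|)%N.
move=> u e ru e0 sep; rewrite exprM -prodr_const.
rewrite (eq_bigl (fun K : {set gT} => (K \subset G) && (\dim (fixv K) < r)%N)).
  apply: ler_prod => K /andP[KG Kr]; rewrite sqr_ge0 /=.
  have [k kK ku] := type_dim_moves ru KG Kr.
  have kG := fintype.subsetP KG k kK.
  have [s sE] := iota_perm kG.
  have [i iu] : exists i, iota (to u k) 0 i != iota u 0 i.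
    apply: contrapT => all; move/negP: ku; apply; apply/eqP/iota_inj/rowP => i.
    by apply/eqP/negPn/negP => iu; apply: all; exists i.
  rewrite (bigD1 k) //= -[leLHS]addr0 lerD //; last first.
    by apply: sumr_ge0 => *; exact: sqn_ge0.
  apply: le_trans (sqr_nrm_le _).
  rewrite ler_sqr ?nnegrE ?normr_ge0 // /nrm.
  apply: le_trans (coord_le_norm _ i); rewrite linearB !mxE.
  by move: iu; rewrite sE sym_actE; exact: sep.
by move=> K; rewrite inE.
Qed.

End PermutationRepresentation.

(** * Invariant polynomials of the symmetric group *)

Section SymmetricPolynomials.
Import -(notations) mpoly.
Variables (R : realType) (n : nat).

Local Notation mpol := (mpoly.mpoly n R).
Local Notation evalp x p := (mpoly.meval (fun i => x 0 i) p).

Lemma poly_fun_mpoly (f : 'rV[R]_n -> R) :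
  poly_fun f -> exists p : mpol, forall x, f x = evalp x p.
Proof.
move/poly_fun_coordP; elim=> {f} [a|_ [i ->]|f g _ [p pE] _ [q qE]
  |f g _ [p pE] _ [q qE]].
- by exists (mpoly.mpolyC n a) => x; rewrite mpoly.mevalC.
- by exists (mpoly.mpolyX R (mpoly.mnm1 i)) => x; rewrite mpoly.mevalXU.
- by exists (p + q) => x; rewrite mpoly.mevalD pE qE.
- by exists (p * q) => x; rewrite mpoly.mevalM pE qE.
Qed.

Lemma gen_algebra_meval (T : Type) (S : set (T -> R)) (g : 'I_n -> T -> R)
    (p : mpol) :
  (forall i, gen_algebra S (g i)) ->
  gen_algebra S (fun x => mpoly.meval (g^~ x) p).
Proof.
move=> Sg; under eq_fun do rewrite mpoly.mevalE.
apply: gen_algebra_sum => m _; apply: gen_algebra_mul.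
  exact: gen_algebra_cst.
by apply: gen_algebra_prod => i _; exact: gen_algebra_exp.
Qed.

Lemma meval_msym (s : 'S_n) (p : mpol) (x : 'rV[R]_n) :
  evalp x (mpoly.msym s p) = evalp (sym_act x s^-1%g) p.
Proof.
pose X := [tuple mpoly.mpolyX R (mpoly.mnm1 (s i)) | i < n].
have -> : mpoly.msym s p = mpoly.comp_mpoly X p.
  rewrite /mpoly.msym /mpoly.comp_mpoly /mpoly.mmap; apply: eq_bigr => m _.
  by congr (_ * _); apply: mpoly.mmap1_eq => i; rewrite tnth_mktuple.
rewrite mpoly.comp_mpoly_meval; apply: mpoly.meval_eq => i.
by rewrite tnth_mktuple mpoly.mevalXU sym_actE invgK.
Qed.

Lemma msymM_perm (s t : 'S_n) (p : mpol) :
  mpoly.msym t (mpoly.msym s p) = mpoly.msym (s * t)%g p.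
Proof.
apply/mpoly.mpolyP => m; rewrite !mpoly.mcoeff_sym; congr (mpoly.mcoeff _ _).
by apply/mpoly.mnmP => i; rewrite !mpoly.mnmE permM.
Qed.

Lemma meval_mesym (j : 'I_n) (x : 'rV[R]_n) :
  evalp x (mpoly.mesym n R j.+1) = elem_sym x 0 j.
Proof.
rewrite mxE /mpoly.mesym raddf_sum; apply: eq_bigr => A _.
rewrite /= (rmorph_prod (mpoly.meval _)); apply: eq_bigr => i _.
exact: mpoly.mevalXU.
Qed.

(** The fundamental theorem on symmetric polynomials, carried over to polynomial
    functions: the symmetrization of any polynomial representing f is symmetric
    and represents n! f. *)
Lemma sym_invariant_gen (f : 'rV[R]_n -> R) :
  invariant_poly (sym_action R n) f ->
  gen_algebra
    [set f | exists i : 'I_n, f = fun x : 'rV[R]_n => elem_sym x 0 i] f.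
Proof.
move=> [/poly_fun_mpoly[p pE] finv].
pose q : mpol := \sum_(s : 'S_n) mpoly.msym s p.
have qsym : q \is @mpoly.symmetric n R.
  apply/mpoly.issymP => t; rewrite /q raddf_sum /=.
  rewrite [RHS](reindex_inj (mulIg t)) /=.
  by apply: eq_bigr => s _; rewrite msymM_perm.
have [r [rq _]] := mpoly.sym_fundamental qsym.
have fE x : f x = (n`!)%:R^-1 * evalp x q.
  rewrite /q raddf_sum /= (eq_bigr (fun=> f x)) => [|s _]; last first.
    by rewrite meval_msym -pE; apply: finv; rewrite inE.
  have -> : \sum_(s : 'S_n) f x = \sum_(s in [set: 'S_n]%SET) f x.
    by apply: eq_bigl => s; rewrite inE.
  rewrite sumr_const cardsT card_Sn -[f x *+ _]mulr_natl mulKf //.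
rewrite (_ : f = fun x => (n`!)%:R^-1 *
    mpoly.meval (fun i => elem_sym x 0 i) r); last first.
  apply/funext => x; rewrite fE -rq mpoly.comp_mpoly_meval; congr (_ * _).
  by apply: mpoly.meval_eq => i; rewrite tnth_mktuple meval_mesym.
apply: gen_algebra_mul; first exact: gen_algebra_cst.
apply: (gen_algebra_meval (g := fun i x => elem_sym x 0 i)) => i.
by apply: gen_algebra_gen; exists i.
Qed.

End SymmetricPolynomials.

(** * Order of vanishing of smooth functions *)

Section Peano.
Variable R : realType.

Definition smooth_fun (g : R -> R) := forall k t, derivable (derive1n k g) t 1.

Lemma smooth_fun_derive1 g : smooth_fun g -> smooth_fun (derive1 g).
Proof. by move=> sg k t; rewrite -derive1Sn; exact: sg k.+1 t. Qed.

(** Smoothness passes to an algebra once its generators are closed under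
    differentiation, since then so is the algebra. *)
Lemma gen_algebra_smooth (S : set (R -> R)) f :
  (forall s, S s -> (forall t, derivable s t 1) /\ S (derive1 s)) ->
  gen_algebra S f -> smooth_fun f.
Proof.
move=> Sder Sf.
have step g : gen_algebra S g ->
    (forall t, derivable g t 1) /\ gen_algebra S (derive1 g).
  elim=> {g} [a|s Ss|g h Sg [dg Sg'] Sh [dh Sh']|g h Sg [dg Sg'] Sh [dh Sh']].
  - split=> [t|]; first exact: derivable_cst.
    rewrite (_ : derive1 _ = fun=> 0); first exact: gen_algebra_cst.
    by apply/funext => t; rewrite derive1_cst.
  - by have [ds Ss'] := Sder _ Ss; split=> //; exact: gen_algebra_gen.
  - split=> [t|]; first exact: derivableD.
    rewrite (_ : derive1 _ = fun t => derive1 g t + derive1 h t).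
      exact: gen_algebra_add.
    by apply/funext => t; rewrite !derive1E -deriveD.
  - split=> [t|]; first exact: derivableM.
    rewrite (_ : derive1 _ = fun t => g t * derive1 h t + h t * derive1 g t).
      by apply: gen_algebra_add; exact: gen_algebra_mul.
    by apply/funext => t; rewrite !derive1E -[RHS]deriveM.
move=> k; apply: (step (derive1n k f) _).1.
by elim: k => // k IH; rewrite derive1nS; exact: (step _ IH).2.
Qed.

(** The derivatives of all orders of the coordinates of c generate an algebra
    closed under differentiation. *)
Lemma smooth_poly_curve n (P : 'rV[R]_n -> R) (c : R -> 'rV[R]_n) :
  poly_fun P -> smooth_curve c -> smooth_fun (fun t => P (c t)).
Proof.
move=> /poly_fun_coordP pP sc.
pose S : set (R -> R) := [set f | exists i k, f = fun t => derive1n k c t 0 i].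
apply: (@gen_algebra_smooth S) => [_ [i [k ->]]|].
  have dk t : derivable (derive1n k c) t 1 by exact: sc.
  split=> [t|]; first by move/derivable_mxP: (dk t); apply.
  exists i, k.+1; apply/funext => t.
  by rewrite derive1nS !derive1E derive_mx ?mxE.
apply: (gen_algebra_comp (phi := c) _ pP) => _ [i ->].
by apply: gen_algebra_gen; exists i, 0%N.
Qed.

Lemma smooth_fun_is_derive g t :
  smooth_fun g -> is_derive t (1 : R) g (derive1 g t).
Proof. by move=> sg; rewrite derive1E; apply: derivableP; exact: sg 0%N t. Qed.

Lemma smooth_fun_continuous g t : smooth_fun g -> {for t, continuous g}.
Proof.
move=> sg; apply: differentiable_continuous; apply/derivable1_diffP.
exact: sg 0%N t.
Qed.

Lemma mean_value_between (h dh : R -> R) a b :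
  (forall s, is_derive s (1 : R) h (dh s)) ->
  exists2 u, `|u - a| <= `|b - a| & h b - h a = dh u * (b - a).
Proof.
move=> hdh; have hc : continuous h.
  move=> s; apply: differentiable_continuous; apply/derivable1_diffP.
  exact: (@ex_derive _ _ _ _ _ _ _ (hdh s)).
have hcw x y : {within `[x, y], continuous h} by exact: continuous_subspaceT.
have [ab|ba|->] := ltgtP a b.
- have [u + ->] := MVT ab (fun x _ => hdh x) (hcw _ _).
  rewrite in_itv /= => /andP[au ub]; exists u => //.
  by rewrite !gtr0_norm ?subr_gt0 // lerD2r ltW.
- have [u + H] := MVT ba (fun x _ => hdh x) (hcw _ _).
  rewrite in_itv /= => /andP[au ub]; exists u => //.
    by rewrite !ltr0_norm ?subr_lt0 // !opprB lerD2l lerN2 ltW.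
  by rewrite -opprB H -mulrN opprB.
- by exists b; rewrite ?lexx // !subrr mulr0.
Qed.

(** By induction on the order: the mean value theorem integrates the estimate for
    the derivative of g. *)
Lemma peano_remainder g t0 k (e : R) : smooth_fun g -> 0 < e ->
  (forall j, (j < k)%N -> derive1n j g t0 = 0) ->
  \forall t \near t0,
    `|g t - derive1n k g t0 / k`!%:R * (t - t0) ^+ k| <= e * `|t - t0| ^+ k.
Proof.
elim: k g e => [|k IH] g e sg e0 g0.
  move/cvgrPdist_le: (@smooth_fun_continuous g t0 sg) => /(_ _ e0).
  apply: filterS => t.
  by rewrite distrC /= !expr0 !mulr1 fact0 divr1.
have {}IH := IH (derive1 g) e (smooth_fun_derive1 sg) e0 _.
have /IH/nbhs_ballP[r r0 rP] j : (j < k)%N -> derive1n j (derive1 g) t0 = 0.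
  by move=> jk; rewrite -derive1Sn; exact: g0.
set a := derive1n k (derive1 g) t0 / k`!%:R in rP.
have aE : derive1n k.+1 g t0 / k.+1`!%:R = a / k.+1%:R.
  by rewrite derive1Sn factS natrM invfM mulrA mulrAC.
apply/nbhs_ballP; exists r => // t; rewrite -ball_normE /= => tr.
pose h s := g s - a / k.+1%:R * (s - t0) ^+ k.+1.
have dh s : is_derive s (1 : R) h ((derive1 g) s - a * (s - t0) ^+ k).
  have dg := smooth_fun_is_derive s sg.
  have -> : h = g - (a / k.+1%:R) *: ((id - cst t0) ^+ k.+1) :> (R -> R).
    by apply/funext => u; rewrite /h !fctE.
  apply: is_derive_eq; rewrite !fctE subr0 /GRing.scale /= mulr1.
  by congr (_ - _); field; rewrite ?nat1r ?natr1 pnatr_eq0.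
have h0 : h t0 = 0.
  by rewrite /h subrr expr0n mulr0 subr0; exact: g0 0%N isT.
rewrite aE -/(h t) -[h t]subr0 -h0.
have [u ut ->] := mean_value_between t0 t dh.
rewrite normrM exprSr mulrA ler_wpM2r //.
apply: (@le_trans _ _ (e * `|u - t0| ^+ k)).
  apply: rP; rewrite -ball_normE /= distrC; apply: le_lt_trans ut _.
  by rewrite distrC.
by rewrite ler_wpM2l ?(ltW e0) // lerXn2r ?nnegrE.
Qed.

(** The exponent is the order of the first derivative that does not vanish. *)
Lemma smooth_nonflat_lower g t0 k :
  smooth_fun g -> derive1n k g t0 != 0 ->
  exists m (c : R), 0 < c /\ \forall t \near t0, c * `|t - t0| ^+ m <= `|g t|.
Proof.
move=> sg gk; have ex : exists k, derive1n k g t0 != 0 by exists k.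
case: (ex_minnP ex) => m gm mmin.
set a := derive1n m g t0 / m`!%:R.
have a0 : 0 < `|a|.
  by rewrite normr_gt0 mulf_neq0 // invr_eq0 pnatr_eq0 -lt0n fact_gt0.
have a2 : 0 < `|a| / 2 by exact: divr_gt0.
have low j : (j < m)%N -> derive1n j g t0 = 0.
  by move=> jm; apply/eqP/negPn/negP => /mmin; rewrite leqNgt jm.
exists m, (`|a| / 2); split=> //.
apply: filterS (peano_remainder sg a2 low) => t; rewrite -/a => H.
have := lerB_dist (a * (t - t0) ^+ m) (a * (t - t0) ^+ m - g t).
rewrite subKr normrM normrX (distrC _ (g t)).
by move: H; lra.
Qed.

Lemma smooth_flat_upper g t0 m (e : R) : smooth_fun g -> 0 < e ->
  (forall k, derive1n k g t0 = 0) ->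
  \forall t \near t0, `|g t| <= e * `|t - t0| ^+ m.
Proof.
move=> sg e0 g0; have := peano_remainder sg e0 (fun j (_ : (j < m)%N) => g0 j).
by apply: filterS => t; rewrite g0 mul0r mul0r subr0.
Qed.

End Peano.

(** * The two stratifications *)

Section Comparison.
Variables (R : realType) (n : nat).

Lemma sym_action_perm g : g \in [set: 'S_n]%G ->
  exists s : 'S_n, forall x : 'rV[R]_n,
    idfun (sym_action R n x g) = sym_act (idfun x) s.
Proof. by exists g. Qed.

Lemma idfun_inj : injective (@idfun 'rV[R]_n).
Proof. by []. Qed.

Local Notation sdim := (type_dim (sym_action R n)).

Lemma skeleton_sym (s : int) (x : 'rV[R]_n) :
  skeleton (sym_action R n) (@elem_sym R n) s (elem_sym x) <-> (sdim x)%:Z <= s.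
Proof.
exact: (skeleton_sigma idfun_inj sym_action_perm (@sym_invariant_gen R n)).
Qed.

Definition merge (u : 'rV[R]_n) (i j : 'I_n) : 'rV[R]_n :=
  \row_k (if u 0 k == u 0 j then u 0 i else u 0 k).

(** Merging two values keeps the isotropy of u and adds the transposition of i
    and j, which does not fix u. *)
Lemma type_dim_merge (u : 'rV[R]_n) i j :
  u 0 i != u 0 j -> (sdim (merge u i j) < sdim u)%N.
Proof.
move=> uij; set w := merge u i j.
have sub : isotropy (sym_action R n) u \subset isotropy (sym_action R n) w.
  apply/fintype.subsetP => g /isotropyP[gG gu]; apply/isotropyP; split=> //.
  apply/rowP => k; have := congr1 (fun x : 'rV_n => x 0 k) gu.
  by rewrite /= !sym_actE !mxE => ->.
have fixP := fixvP idfun_inj sym_action_perm _ (isotropy_sub (sym_action R n) _).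
have le : (fixv (sym_action R n) (isotropy (sym_action R n) w) <=
    fixv (sym_action R n) (isotropy (sym_action R n) u))%VS.
  apply/subvP => x /fixP xw; apply/fixP => g gu; apply: xw.
  exact: (fintype.subsetP sub).
rewrite ltn_neqAle dimvS // andbT; apply/negP => eqd.
have : u \in fixv (sym_action R n) (isotropy (sym_action R n) w).
  have -> : fixv (sym_action R n) (isotropy (sym_action R n) w) =
      fixv (sym_action R n) (isotropy (sym_action R n) u).
    by apply/eqP; rewrite eqEdim le /=; move: eqd; rewrite /type_dim => /eqP ->.
  exact: (mem_fixv_isotropy idfun_inj sym_action_perm).
move=> /fixP /(_ (tperm i j)) tu; have := uij; rewrite -{1}tu; last first.
  apply/isotropyP; split; first by rewrite inE.
  apply/rowP => k; rewrite /= sym_actE tpermV !mxE.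
  have [->|ki] := eqVneq k i; first by rewrite tpermL eqxx (negPf uij).
  have [->|kj] := eqVneq k j; first by rewrite tpermR eqxx (negPf uij).
  by rewrite tpermD // eq_sym.
by rewrite /= sym_actE tpermV tpermL eqxx.
Qed.

(** At the merged point, which is within |u_i - u_j| of u, the function f o E
    vanishes. *)
Lemma coordinate_separation (f : 'rV[R]_n -> R) (s : nat) (B : R) :
  poly_fun f ->
  (forall x, (sdim x < s)%N -> f (elem_sym x) = 0) ->
  exists2 L, 0 < L & forall u i j, `|u| <= B -> (sdim u <= s)%N ->
    u 0 i != u 0 j -> `|f (elem_sym u)| <= L * `|u 0 i - u 0 j|.
Proof.
move=> /poly_fun_comp_elem_sym/poly_fun_bounded_lipschitz - /(_ B)[L L0 LP] f0.
exists L => // u i j uB us uij.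
have B0 : 0 <= B := le_trans (normr_ge0 _) uB.
have mB : `|merge u i j| <= B.
  apply: norm_le_coord => // k; rewrite mxE.
  by case: ifP => _; apply: le_trans uB; exact: coord_le_norm.
have [_] := LP _ _ uB mB; rewrite /= (f0 (merge u i j)) ?subr0; last first.
  exact: leq_trans (type_dim_merge uij) us.
move=> /le_trans; apply; rewrite ler_wpM2l ?(ltW L0) //.
apply: norm_le_coord => // k; rewrite !mxE; case: ifP => [/eqP ->|_].
  by rewrite distrC.
by rewrite subrr normr0.
Qed.

Section Subspace.
Variable U : {vspace 'rV[R]_n}.

Lemma weyl_action_perm g : g \in weyl U ->
  exists s : 'S_n, forall x, vsval (weyl_action U x g) = sym_act (vsval x) s.
Proof.
by move=> /morphimP[s _ sN ->]; exists s => x; exact: weyl_act_coset.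
Qed.

Hypothesis hgen : gen_algebra
    [set f | exists i : 'I_n, f = (fun x : subvs_of U => elem_sym_on x 0 i)]
  = invariant_poly (weyl_action U).

Lemma weyl_gen f : invariant_poly (weyl_action U) f -> gen_algebra
  [set f | exists i : 'I_n, f = fun x : subvs_of U => elem_sym (vsval x) 0 i] f.
Proof. by rewrite -hgen. Qed.

Local Notation wdim := (type_dim (weyl_action U)).
Local Notation wskel := (skeleton (weyl_action U) (@elem_sym_on R n U)).

Lemma skeleton_weyl (s : int) (u : subvs_of U) :
  wskel s (elem_sym (vsval u)) <-> (wdim u)%:Z <= s.
Proof.
exact: (skeleton_sigma (@subvs_inj _ _ U) weyl_action_perm weyl_gen).
Qed.

(** The sum of the squares of the coordinates is a polynomial in the invariants,
    hence bounded along c near t0. *)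
Lemma bounded_lifts (c : R -> 'rV[R]_n) (t0 : R) : smooth_curve c ->
  exists B, \forall t \near t0, forall u : subvs_of U,
    elem_sym (vsval u) = c t -> `|vsval u| <= B.
Proof.
move=> sc.
have [|P pP PE] := invariant_factor weyl_gen (f := sqn (@vsval _ _ U)).
  split.
    have := @poly_fun_sqn _ _ _ (@vsval _ _ U) 0.
    by under eq_fun do rewrite subr0.
  by move=> g x gW; exact: (sqn_act weyl_action_perm).
have Pc : {for t0, continuous (fun t => P (c t))}.
  exact/smooth_fun_continuous/smooth_poly_curve.
exists (`|P (c t0)| + 1).
move/cvgrPdist_le: Pc => /(_ _ ltr01); apply: filterS => t Pt u uc.
have Pu : sqn (@vsval _ _ U) u <= `|P (c t0)| + 1.
  rewrite PE uc; apply: le_trans (ler_norm _) _; rewrite -lerBlDl.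
  by apply: le_trans (lerB_dist _ _) _; rewrite distrC.
have u2 := le_trans (sqr_nrm_le (@vsval _ _ U) u) Pu.
rewrite -/(nrm (@vsval _ _ U) u).
rewrite -ler_sqr ?nnegrE ?normr_ge0 ?addr_ge0 //.
apply: (le_trans u2); rewrite expr2 ler_peMl ?addr_ge0 //.
by rewrite lerDr.
Qed.

(** The orbit type level s' and the equation P of its lower strata are chosen
    first; flatness of P o c would then push c into these strata near t0. *)
Lemma normally_nonflat_weyl (c : R -> 'rV[R]_n) (t0 : R) : smooth_curve c ->
  (forall t, range (@elem_sym_on R n U) (c t)) ->
  normally_nonflat (sym_action R n) (@elem_sym R n) c t0 ->
  normally_nonflat (weyl_action U) (@elem_sym_on R n U) c t0.
Proof.
move=> sc cU [s [cs _] [f [pf fs] [k fk]]].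
have f0 x : (sdim x < s)%N -> f (elem_sym x) = 0.
  move=> xs; apply/fs/skeleton_sym.
  by rewrite lerBrDr -[1]/(1%N%:Z) -PoszD lez_nat addn1.
have [s' [cs' s'min]] : exists s', stratum_level (weyl_action U)
    (@elem_sym_on R n U) c t0 s'.
  have ex : exists r, `[< \forall u \near t0, wskel (r%:Z) (c u) >].
    have top t : wskel (\dim {: subvs_of U})%N%:Z (c t).
      have [u _ <-] := cU t; apply/skeleton_weyl; rewrite lez_nat.
      exact/dimvS/subvf.
    exists (\dim {: subvs_of U})%N; apply/asboolP.
    exact: (@filterE _ (nbhs t0) _ _ top).
  case: (ex_minnP ex) => r /asboolP cr rmin; exists r; split=> // q cq.
  by apply: rmin; apply/asboolP.
exists s'; first by split.
have [P pP PE] := invariant_factor weyl_gen (lowdim_invariant (@subvs_inj _ _ U)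
  weyl_action_perm s').
have Pideal : stratum_ideal (weyl_action U) (@elem_sym_on R n U) s'%:Z P.
  split=> // z zs; have [u uz] : exists u : subvs_of U, elem_sym (vsval u) = z.
    have := zs; rewrite (skeletonE (@subvs_inj _ _ U) weyl_action_perm weyl_gen).
    by case=> u _ uz; exists u.
  rewrite -uz -PE; apply: lowdim_eq0.
  move: zs; rewrite -uz => /skeleton_weyl.
  by rewrite lerBrDr -[1]/(1%N%:Z) -PoszD lez_nat addn1.
exists P => //; apply: contrapT => Pflat.
have {}Pflat j : derive1n j (fun t => P (c t)) t0 = 0.
  apply: contrapT => /eqP Pj; apply: Pflat; exists j.
  by rewrite mulf_neq0 // invr_eq0 pnatr_eq0 -lt0n fact_gt0.
have sP := smooth_poly_curve pP sc.
have fk0 : derive1n k (fun t => f (c t)) t0 != 0.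
  by apply: contraNneq fk => ->; rewrite mul0r.
have [m [c0 [c00 low]]] := smooth_nonflat_lower (smooth_poly_curve pf sc) fk0.
have [B cB] := bounded_lifts t0 sc.
have [L L0 LP] := coordinate_separation B pf f0.
have [M MP] := lowdim_lower_bound (@subvs_inj _ _ U) weyl_action_perm s'.
(* half of the constant in the lower bound (c0 / L)^M |t - t0|^(m M) for P o c *)
have e0 : 0 < (c0 / L) ^+ M / 2 by rewrite divr_gt0 // exprn_gt0 // divr_gt0.
have flat := smooth_flat_upper (m * M) sP e0 Pflat.
(* small puts c into the skeleton of dimension s' - 1 near t0 *)
suff small : \forall t \near t0, forall u : subvs_of U,
    elem_sym (vsval u) = c t -> (wdim u < s')%N.
  have cs1 : \forall t \near t0, forall r, s' = r.+1 -> wskel r%:Z (c t).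
    apply: filterS small => t tsmall r s'r; have [u _ uc] := cU t.
    by rewrite -uc; apply/skeleton_weyl; rewrite lez_nat -ltnS -s'r; exact: tsmall.
  case s'E : s' => [|r].
    have := nbhs_singleton small; have [u _ uc] := cU t0.
    by move=> /(_ u uc); rewrite s'E.
  have /s'min : \forall t \near t0, wskel r%:Z (c t).
    by apply: filterS cs1 => t; exact.
  by rewrite s'E ltnn.
near=> t => u uc; rewrite ltnNge; apply/negP => s'u.
have [tt0|tt0] := eqVneq t t0.
  have := lowdim_gt0 (@subvs_inj _ _ U) weyl_action_perm s'u.
  by rewrite PE uc tt0; have := Pflat 0%N; rewrite derive1n0 => ->; rewrite ltxx.
have us : (sdim (vsval u) <= s)%N.
  have : skeleton (sym_action R n) (@elem_sym R n) s%:Z (c t) by near: t.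
  by rewrite -uc => /skeleton_sym; rewrite lez_nat.
have uB : `|vsval u| <= B by move: u uc {s'u us}; near: t.
have ft : c0 * `|t - t0| ^+ m <= `|f (c t)| by near: t.
have Pt : `|P (c t)| <= (c0 / L) ^+ M / 2 * `|t - t0| ^+ (m * M) by near: t.
have x0 : 0 < `|t - t0| ^+ m by rewrite exprn_gt0 // normr_gt0 subr_eq0.
have e1 : 0 <= c0 / L * `|t - t0| ^+ m.
  by rewrite mulr_ge0 ?(ltW x0) // divr_ge0 // ltW.
have := MP u _ s'u e1.
rewrite PE uc exprMn -exprM => /(_ _)/le_trans => H.
have : (c0 / L) ^+ M * `|t - t0| ^+ (m * M) <=
    (c0 / L) ^+ M / 2 * `|t - t0| ^+ (m * M).
  apply: le_trans (H _ _ (ler_norm _)) Pt => i j uij.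
  rewrite mulrAC ler_pdivrMr // mulrC [leRHS]mulrC.
  by rewrite mulrC (le_trans ft) // -uc; exact: LP.
rewrite leNgt => /negP; apply; rewrite ltr_pM2r; last first.
  by rewrite exprn_gt0 // normr_gt0 subr_eq0.
have cM : 0 < (c0 / L) ^+ M by rewrite exprn_gt0 // divr_gt0.
lra.
Unshelve. all: by end_near. Qed.

End Subspace.
End Comparison.

Theorem proposition4p3 (R : realType) (n : nat) (U : {vspace 'rV[R]_n})
    (hgen : gen_algebra
              [set f | exists i : 'I_n,
                         f = (fun x : subvs_of U => elem_sym_on x 0 i)]
            = invariant_poly (weyl_action U))
    (c : R -> 'rV[R]_n) (hc : smooth_curve c)
    (hcU : forall t, range (@elem_sym_on R n U) (c t)) (t0 : R) :
  normally_nonflat (sym_action R n) (@elem_sym R n) c t0 ->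
  normally_nonflat (weyl_action U) (@elem_sym_on R n U) c t0.
Proof. exact: normally_nonflat_weyl. Qed.
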